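(* Let $G$ be a finite group. Then $\Lambda(G)$ is an abelian subgroup of $\mathrm{Aut}(\mathcal{D}(G))$, and $\Lambda(G)\cong\mathrm{End}(Z(G))$ as groups (with $\mathrm{End}(Z(G))$ a group under pointwise multiplication).
   Context: The base field $\mathbbm{k}$ is algebraically closed of characteristic zero. For a finite group $G$, $\mathbbm{k}^G$ is the linear dual of $\mathbbm{k}G$, with dual basis $\{e_g\}_{g\in G}$ and identity $\varepsilon=\sum_{g}e_g$. The Drinfeld double $\mathcal{D}(G)$ is the Hopf algebra with basis $e_g\# h$ ($g,h\in G$), multiplication $(e_g\# g')(e_h\# h')=\delta_{g,\,g'hg'^{-1}}\,e_g\# g'h'$, unit $\varepsilon\# 1$, and coalgebra structure $(\mathbbm{k}^G)^{\mathrm{cop}}\otimes\mathbbm{k}G$. $\mathrm{Aut}(\mathcal{D}(G))$ is its group of Hopf algebra automorphisms. $\Lambda(G)$ is the set of Hopf algebra automorphisms of $\mathcal{D}(G)$ of the form $a\# g\mapsto a_{(1)}\# p(a_{(2)})g$ for $a\in\mathbbm{k}^G$, $g\in G$, where $p:(\mathbbm{k}^G)^{\mathrm{cop}}\to\mathbbm{k}G$ is a morphism of Hopf algebras and Sweedler notation is in $(\mathbbm{k}^G)^{\mathrm{cop}}$. *)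

(* Defs.v *)
From HB Require Import structures.
From mathcomp Require Import all_boot all_order all_algebra all_fingroup.
From mathcomp Require Import all_solvable boolp.

Set Implicit Arguments.
Unset Strict Implicit.
Unset Printing Implicit Defensive.

Import GRing.Theory.
Local Open Scope ring_scope.

(* Finite-dimensional spaces are coordinate spaces k^B on a finite basis B;
   the tensor product of k^B and k^C is k^(B * C). *)
Notation vsp k B := {ffun B -> k^o}.

Section FreeSpaces.
Variable k : fieldType.

Definition bas (B : finType) (b : B) : vsp k B := [ffun x => (x == b)%:R].

Section Lext.
Variables (B : finType) (W : vectType k) (f : B -> W).

Definition lext_fun (v : vsp k B) : W := \sum_b (v b : k) *: f b.

Fact lext_is_linear : linear lext_fun.
Proof.
move=> a u v; rewrite /lext_fun scaler_sumr -big_split /=.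
by apply: eq_bigr => b _; rewrite !ffunE scalerDl scalerA.
Qed.
HB.instance Definition _ :=
  GRing.isLinear.Build k (vsp k B) W _ lext_fun lext_is_linear.

Definition lext : 'Hom(vsp k B, W) := linfun lext_fun.

Lemma lextE b : lext (bas b) = f b.
Proof.
rewrite lfunE /= /lext_fun (bigD1 b) //= ffunE eqxx scale1r.
by rewrite big1 ?addr0 // => c /negPf cb; rewrite ffunE cb scale0r.
Qed.
End Lext.

Definition tens (B C : finType) (x : vsp k B) (y : vsp k C) : vsp k (B * C)%type :=
  [ffun p => (x p.1 : k) * y p.2].

Definition tmap (B B' C C' : finType)
    (f : 'Hom(vsp k B, vsp k B')) (g : 'Hom(vsp k C, vsp k C')) :
    'Hom(vsp k (B * C)%type, vsp k (B' * C')%type) :=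
  lext (fun p => tens (f (bas p.1)) (g (bas p.2))).

Definition tassoc (B : finType) :
    'Hom(vsp k (B * B * B)%type, vsp k (B * (B * B))%type) :=
  lext (fun p => bas (p.1.1, (p.1.2, p.2))).

Definition tswap23 (B : finType) :
    'Hom(vsp k ((B * B) * (B * B))%type, vsp k ((B * B) * (B * B))%type) :=
  lext (fun p => bas ((p.1.1, p.2.1), (p.1.2, p.2.2))).

Lemma bas_sum (B : finType) (x : vsp k B) : x = \sum_b (x b : k) *: bas b.
Proof.
apply/ffunP => c; rewrite sum_ffunE (bigD1 c) //= !ffunE eqxx.
rewrite big1 ?addr0; first by rewrite -[_ *: _]/(_ * _) mulr1.
by move=> b /negPf bc; rewrite !ffunE eq_sym bc; apply: mulr0.
Qed.

Lemma hom_basP (B : finType) (W : vectType k) (f g : 'Hom(vsp k B, W)) :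
  (forall b, f (bas b) = g (bas b)) -> f = g.
Proof.
move=> fg; apply/lfunP => x; rewrite (bas_sum x) !linear_sum.
by apply: eq_bigr => b _; rewrite !linearZ /= fg.
Qed.

Section Tens.
Variables B C : finType.
Implicit Types (x : vsp k B) (y : vsp k C).

Lemma tens_bas (b : B) (c : C) : tens (bas b) (bas c) = bas (b, c).
Proof. by apply/ffunP => -[i j]; rewrite !ffunE xpair_eqE -natrM mulnb. Qed.

Lemma tensZl (a : k) x y : tens (a *: x) y = a *: tens x y.
Proof. by apply/ffunP => p; rewrite !ffunE -[a *: _]/(a * _) -mulrA. Qed.

Lemma tensZr (a : k) x y : tens x (a *: y) = a *: tens x y.
Proof. by apply/ffunP => p; rewrite !ffunE -[a *: _]/(a * _) mulrCA. Qed.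

Lemma tens_suml (I : finType) (F : I -> vsp k B) y :
  tens (\sum_i F i) y = \sum_i tens (F i) y.
Proof.
apply/ffunP => p; rewrite ffunE !sum_ffunE mulr_suml.
by apply: eq_bigr => i _; rewrite ffunE.
Qed.

Lemma tens_sumr (I : finType) x (F : I -> vsp k C) :
  tens x (\sum_i F i) = \sum_i tens x (F i).
Proof.
apply/ffunP => p; rewrite ffunE !sum_ffunE mulr_sumr.
by apply: eq_bigr => i _; rewrite ffunE.
Qed.
End Tens.

Lemma tmap_bas (B B' C C' : finType)
    (f : 'Hom(vsp k B, vsp k B')) (g : 'Hom(vsp k C, vsp k C')) b c :
  tmap f g (bas (b, c)) = tens (f (bas b)) (g (bas c)).
Proof. by rewrite lextE. Qed.

Lemma tassoc_bas (B : finType) (a b c : B) :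
  tassoc B (bas (a, b, c)) = bas (a, (b, c)).
Proof. by rewrite lextE. Qed.

Lemma tswap23_bas (B : finType) (a b c d : B) :
  tswap23 B (bas ((a, b), (c, d))) = bas ((a, c), (b, d)).
Proof. by rewrite lextE. Qed.

Record hopf_alg (B : finType) := HopfAlg {
  hmul : 'Hom(vsp k (B * B)%type, vsp k B);
  hone : vsp k B;
  hcomul : 'Hom(vsp k B, vsp k (B * B)%type);
  hcounit : 'Hom(vsp k B, k^o);
  hanti : 'End(vsp k B);
  hmulA : (hmul \o tmap hmul \1 = hmul \o tmap \1 hmul \o tassoc B)%VF;
  hmul1x : forall x, hmul (tens hone x) = x;
  hmulx1 : forall x, hmul (tens x hone) = x;
  hcomulA : (tassoc B \o tmap hcomul \1 \o hcomul
             = tmap \1 hcomul \o hcomul)%VF;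
  hcounitl : (lext (fun p => (hcounit (bas p.1) : k) *: bas p.2) \o hcomul
              = \1)%VF;
  hcounitr : (lext (fun p => (hcounit (bas p.2) : k) *: bas p.1) \o hcomul
              = \1)%VF;
  hcomulM : (hcomul \o hmul
             = tmap hmul hmul \o tswap23 B \o tmap hcomul hcomul)%VF;
  hcomul1 : hcomul hone = tens hone hone;
  hcounitM : forall x y,
    hcounit (hmul (tens x y)) = (hcounit x : k) * hcounit y;
  hcounit1 : hcounit hone = (1 : k);
  hantil : forall x, (hmul \o tmap hanti \1 \o hcomul)%VF x
                     = (hcounit x : k) *: hone;
  hantir : forall x, (hmul \o tmap \1 hanti \o hcomul)%VF x
                     = (hcounit x : k) *: hone
}.

Definition hprod (B : finType) (H : hopf_alg B) (x y : vsp k B) : vsp k B :=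
  hmul H (tens x y).

(* For bialgebra maps between Hopf algebras, hmor_anti is automatic. *)
Record hopf_mor (B C : finType) (H : hopf_alg B) (K : hopf_alg C)
    (f : 'Hom(vsp k B, vsp k C)) : Prop := HopfMor {
  hmorM : {morph f : x y / hprod H x y >-> hprod K x y};
  hmor1 : f (hone H) = hone K;
  hmor_comul : forall x, hcomul K (f x) = tmap f f (hcomul H x);
  hmor_counit : forall x, hcounit K (f x) = hcounit H x;
  hmor_anti : {morph f : x / hanti H x >-> hanti K x}
}.

End FreeSpaces.

Arguments bas {k B} b.

Section HopfLemmas.
Variable k : fieldType.

Lemma eq_on_bas (B : finType) (W : vectType k) (F : 'Hom(vsp k B, W))
    (e : 'Hom(vsp k B, k^o)) (w : W) :
  (forall b, F (bas b) = (e (bas b) : k) *: w) ->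
  forall x, F x = (e x : k) *: w.
Proof.
move=> Fb x; rewrite {1}(bas_sum x) [in RHS](bas_sum x) !linear_sum scaler_suml.
by apply: eq_bigr => b _; rewrite !linearZ /= Fb scalerA.
Qed.

Lemma unit_on_basl (B : finType) (m : 'Hom(vsp k (B * B)%type, vsp k B)) e :
  (forall b, m (tens e (bas b)) = bas b) -> forall x, m (tens e x) = x.
Proof.
move=> mb x; rewrite [in LHS](bas_sum x) tens_sumr linear_sum [RHS]bas_sum.
by apply: eq_bigr => b _; rewrite tensZr linearZ /= mb.
Qed.

Lemma unit_on_basr (B : finType) (m : 'Hom(vsp k (B * B)%type, vsp k B)) e :
  (forall b, m (tens (bas b) e) = bas b) -> forall x, m (tens x e) = x.
Proof.
move=> mb x; rewrite [in LHS](bas_sum x) tens_suml linear_sum [RHS]bas_sum.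
by apply: eq_bigr => b _; rewrite tensZl linearZ /= mb.
Qed.

Lemma counitM_on_bas (B : finType) (m : 'Hom(vsp k (B * B)%type, vsp k B))
    (e : 'Hom(vsp k B, k^o)) :
  (forall b c, e (m (bas (b, c))) = (e (bas b) : k) * e (bas c)) ->
  forall x y, e (m (tens x y)) = (e x : k) * e y.
Proof.
move=> eb x y; rewrite (bas_sum x) (bas_sum y) tens_suml !linear_sum mulr_suml.
apply: eq_bigr => b _; rewrite mulr_sumr tens_sumr !linear_sum.
apply: eq_bigr => c _; rewrite tensZl tensZr !linearZ /= tens_bas eb.
rewrite -[_ *: (_ *: _)]/(_ * (_ * _)) -[x b *: _]/(_ * _) -[y c *: _]/(_ * _).
by rewrite -mulrA; congr (_ * _); rewrite mulrCA.
Qed.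

End HopfLemmas.

Section DrinfeldDouble.
Variables (k : fieldType) (gT : finGroupType).
Local Notation G := (gT : finType).

Definition kG_mul : 'Hom(vsp k (G * G)%type, vsp k G) :=
  lext (fun p => bas (p.1 * p.2)%g).
Definition kG_comul : 'Hom(vsp k G, vsp k (G * G)%type) :=
  lext (fun g => bas (g, g)).
Definition kG_counit : 'Hom(vsp k G, k^o) := lext (fun=> 1 : k^o).
Definition kG_anti : 'End(vsp k G) := lext (fun g => bas (g^-1)%g).

Lemma kG_mulE g h : kG_mul (bas (g, h)) = bas (g * h)%g.
Proof. by rewrite lextE. Qed.
Lemma kG_comulE g : kG_comul (bas g) = bas (g, g). Proof. by rewrite lextE. Qed.
Lemma kG_counitE g : kG_counit (bas g) = 1. Proof. by rewrite lextE. Qed.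
Lemma kG_antiE g : kG_anti (bas g) = bas (g^-1)%g.
Proof. by rewrite lextE. Qed.
Let kE := (kG_mulE, kG_comulE, kG_counitE, kG_antiE, tmap_bas, tassoc_bas,
  tswap23_bas, tens_bas, id_lfunE, comp_lfunE).

Definition group_algebra : hopf_alg k G.
Proof.
refine (@HopfAlg k G kG_mul (bas 1%g) kG_comul kG_counit kG_anti
  _ _ _ _ _ _ _ _ _ _ _ _).
- by apply: hom_basP => -[[g h] i]; rewrite !kE mulgA.
- by apply: unit_on_basl => g; rewrite !kE mul1g.
- by apply: unit_on_basr => g; rewrite !kE mulg1.
- by apply: hom_basP => g; rewrite !kE.
- by apply: hom_basP => g; rewrite !kE lextE !kE scale1r.
- by apply: hom_basP => g; rewrite !kE lextE !kE scale1r.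
- by apply: hom_basP => -[g h]; rewrite !kE.
- by rewrite !kE.
- by apply: counitM_on_bas => g h; rewrite !kE mulr1.
- by rewrite !kE.
- by apply: eq_on_bas => g; rewrite !kE mulVg scale1r.
- by apply: eq_on_bas => g; rewrite !kE mulgV scale1r.
Defined.

(* (k^G)^cop, on the basis e_g := bas g.  In k^G the coproduct of e_g is the
   sum of the e_a (x) e_b over a * b = g; here the two legs are exchanged. *)

Definition dual_mul : 'Hom(vsp k (G * G)%type, vsp k G) :=
  lext (fun p => (p.1 == p.2)%:R *: bas p.1).
Definition dual_one : vsp k G := \sum_(g : gT) bas g.
Definition dual_comul : 'Hom(vsp k G, vsp k (G * G)%type) :=
  lext (fun g => \sum_(p : gT * gT | (p.2 * p.1)%g == g) bas p).
Definition dual_counit : 'Hom(vsp k G, k^o) :=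
  lext (fun g => (g == 1%g)%:R : k^o).
Definition dual_anti : 'End(vsp k G) := lext (fun g => bas (g^-1)%g).

Lemma dual_mulE g h : dual_mul (bas (g, h)) = (g == h)%:R *: bas g.
Proof. by rewrite lextE. Qed.
Lemma dual_comulE g :
  dual_comul (bas g) = \sum_(u : gT) bas ((u^-1 * g)%g, u).
Proof.
rewrite lextE /=; rewrite (reindex_onto (fun u => ((u^-1 * g)%g, u)) snd) /=.
  by apply: eq_bigl => u; rewrite mulgA mulgV mul1g !eqxx.
by move=> [a b] /= /eqP <-; rewrite mulgA mulVg mul1g.
Qed.
Lemma dual_counitE g : dual_counit (bas g) = (g == 1%g)%:R.
Proof. by rewrite lextE. Qed.
Lemma dual_antiE g : dual_anti (bas g) = bas (g^-1)%g.
Proof. by rewrite lextE. Qed.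
Let dE := (dual_mulE, dual_comulE, dual_counitE, dual_antiE, tmap_bas,
  tassoc_bas, tswap23_bas, tens_bas, id_lfunE, comp_lfunE).

Lemma sum_delta (W : vectType k) (u0 : gT) (P : gT -> bool) (F : gT -> W) :
  (forall u, P u = (u == u0)) -> \sum_u (P u)%:R *: F u = F u0.
Proof.
move=> Pu; rewrite (bigD1 u0) //= Pu eqxx scale1r big1 ?addr0 // => u.
by rewrite Pu => /negPf->; rewrite scale0r.
Qed.

Definition dual_cop : hopf_alg k G.
Proof.
refine (@HopfAlg k G dual_mul dual_one dual_comul dual_counit dual_anti
  _ _ _ _ _ _ _ _ _ _ _ _).
- apply: hom_basP => -[[g h] i]; rewrite !dE tensZl tensZr !linearZ /= !dE.
  case: (g =P h) => [<-|_]; last by rewrite !scale0r scaler0.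
  by rewrite !scale1r.
- apply: unit_on_basl => g; rewrite /dual_one tens_suml linear_sum /=.
  by under eq_bigr do rewrite !dE; rewrite (@sum_delta _ g).
- apply: unit_on_basr => g; rewrite /dual_one tens_sumr linear_sum /=.
  under eq_bigr do rewrite !dE.
  by rewrite (@sum_delta _ g _ (fun=> bas g)) // => u; rewrite eq_sym.
- apply: hom_basP => g; rewrite !dE !linear_sum /=.
  under eq_bigr do rewrite !dE tens_suml linear_sum /=.
  under [RHS]eq_bigr do rewrite !dE tens_sumr /=.
  rewrite [RHS]exchange_big /=; apply: eq_bigr => u _.
  rewrite [RHS](reindex_inj (mulgI u)) /=; apply: eq_bigr => v _.
  by rewrite !dE invMg mulKg mulgA.
- apply: hom_basP => g; rewrite !dE linear_sum /=.
  under eq_bigr do rewrite lextE !dE /=.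
  by rewrite (@sum_delta _ g _ bas) // => u; rewrite -eq_mulVg1 .
- apply: hom_basP => g; rewrite !dE linear_sum /=.
  under eq_bigr do rewrite lextE !dE /=.
  by rewrite (@sum_delta _ 1%g _ (fun u => bas (u^-1 * g)%g)) // invg1 mul1g.
- apply: hom_basP => -[g h]; rewrite !dE linearZ /= dE tens_suml !linear_sum /=.
  transitivity (\sum_(u : gT) \sum_(v : gT)
     (u == v)%:R *: ((u^-1 * g == v^-1 * h)%g%:R *:
       (bas ((u^-1 * g)%g, u) : vsp k (G * G)%type))); last first.
    apply: eq_bigr => u _; rewrite tens_sumr !linear_sum /=.
    apply: eq_bigr => v _; rewrite !dE tensZl tensZr !dE.
    by rewrite !scalerA mulrC.
  apply: eq_bigr => u _; rewrite /=.
  rewrite (@sum_delta _ u _ (fun v => (u^-1 * g == v^-1 * h)%g%:R *: _)).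
    by rewrite (inj_eq (mulgI _)).
  by move=> v; rewrite eq_sym.
- rewrite /dual_one linear_sum tens_suml /=.
  under eq_bigr do rewrite dE; under [RHS]eq_bigr do rewrite tens_sumr.
  rewrite exchange_big [RHS]exchange_big /=; apply: eq_bigr => u _.
  rewrite (reindex_inj (mulgI u)) /=; apply: eq_bigr => v _.
  by rewrite mulKg dE.
- apply: counitM_on_bas => g h; rewrite !dE linearZ /= !dE.
  rewrite -[_ *: _]/(_ * _) -!natrM !mulnb.
  by case: (g =P h) => [->|]; rewrite ?andbb //=; 
    case: (g =P 1%g) => // ->; case: eqP => // ->.
- rewrite /dual_one linear_sum /= (bigD1 1%g) //= dE eqxx big1 ?addr0 //.
  by move=> g /negPf g1; rewrite dE g1.
- apply: eq_on_bas => g; rewrite !dE linear_sum scaler_sumr !linear_sum /=.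
  apply: eq_bigr => u _; rewrite !dE invMg invgK.
  rewrite -{2}(mul1g u) (inj_eq (mulIg u)) eq_invg1.
  by case: eqP => [->|_]; rewrite ?scale0r // invg1 mul1g.
- apply: eq_on_bas => g; rewrite !dE linear_sum scaler_sumr !linear_sum /=.
  rewrite [RHS](reindex_inj (@invg_inj _)) /=.
  apply: eq_bigr => u _; rewrite !dE -{2}(mulg1 (u^-1)%g) (inj_eq (mulgI _)).
  by case: eqP => [->|_]; rewrite ?scale0r // mulg1.
Defined.

(* D(G), on the basis e_g # x := bas (g, x); hence a # y is tens a y. *)

Definition dbl_mul : 'Hom(vsp k ((G * G) * (G * G))%type, vsp k (G * G)%type) :=
  lext (fun p => let: ((g, x), (h, y)) := p in
    (g == x * h * x^-1)%g%:R *: bas (g, (x * y)%g)).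
Definition dbl_one : vsp k (G * G)%type := tens dual_one (bas 1%g).
Definition dbl_comul :
    'Hom(vsp k (G * G)%type, vsp k ((G * G) * (G * G))%type) :=
  (tswap23 k G \o tmap (hcomul dual_cop) (hcomul group_algebra))%VF.
Definition dbl_counit : 'Hom(vsp k (G * G)%type, k^o) :=
  lext (fun p => (hcounit dual_cop (bas p.1) : k)
                 * hcounit group_algebra (bas p.2) : k^o).
Definition dbl_anti : 'End(vsp k (G * G)%type) :=
  lext (fun p => bas ((p.2^-1 * p.1^-1 * p.2)%g, (p.2^-1)%g)).

Lemma dbl_mulE (g x h y : gT) :
  dbl_mul (bas ((g, x), (h, y))) = (g == x * h * x^-1)%g%:R *: bas (g, (x * y)%g).
Proof. by rewrite lextE. Qed.
Lemma dbl_oneE : dbl_one = \sum_(g : gT) bas (g, 1%g).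
Proof.
by rewrite /dbl_one tens_suml; apply: eq_bigr => g _; rewrite tens_bas.
Qed.
Lemma dbl_comulE (g x : gT) :
  dbl_comul (bas (g, x)) = \sum_(u : gT) bas (((u^-1 * g)%g, x), (u, x)).
Proof.
rewrite comp_lfunE tmap_bas dual_comulE kG_comulE tens_suml linear_sum.
by apply: eq_bigr => u _; rewrite tens_bas /= tswap23_bas.
Qed.
Lemma dbl_counitE (g x : gT) : dbl_counit (bas (g, x)) = (g == 1%g)%:R.
Proof. by rewrite lextE /= dual_counitE kG_counitE mulr1. Qed.
Lemma dbl_antiE (g x : gT) :
  dbl_anti (bas (g, x)) = bas ((x^-1 * g^-1 * x)%g, (x^-1)%g).
Proof. by rewrite lextE. Qed.
Let DE := (dbl_mulE, dbl_comulE, dbl_counitE, dbl_antiE, tmap_bas,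
  tassoc_bas, tswap23_bas, tens_bas, id_lfunE, comp_lfunE).

Lemma conj_eq1 (x h : gT) : (x * h * x^-1 == 1)%g = (h == 1)%g.
Proof. by rewrite -eq_mulgV1 -{2}(mulg1 x) (inj_eq (mulgI x)). Qed.

Lemma eq_conjC (g x u : gT) : (g == x * u * x^-1)%g = (u == x^-1 * g * x)%g.
Proof.
by apply/eqP/eqP => ->; rewrite !mulgA ?mulVg ?mulgV mul1g ?mulgKV ?mulgK.
Qed.

Definition drinfeld_double : hopf_alg k (G * G)%type.
Proof.
refine (@HopfAlg k (G * G)%type dbl_mul dbl_one dbl_comul dbl_counit dbl_anti
  _ _ _ _ _ _ _ _ _ _ _ _).
- apply: hom_basP => -[[[g x] [h y]] [i z]].
  rewrite !DE tensZl tensZr !linearZ /= !DE !scalerA mulgA -!natrM !mulnb.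
  congr (_ *: _); congr (nat_of_bool _)%:R.
  case: eqP => [->|] /=; case: (h =P _) => [->|] //=.
    by rewrite invMg !mulgA eqxx.
  rewrite invMg => hy; apply/eqP => e; case: hy; move: e; rewrite !mulgA.
  by move/mulIg; rewrite -!mulgA => /mulgI.
- apply: unit_on_basl => -[g x]; rewrite dbl_oneE tens_suml linear_sum /=.
  under eq_bigr do rewrite !DE !mul1g invg1 mulg1.
  by rewrite (@sum_delta _ g _ (fun u => bas (u, x))).
- apply: unit_on_basr => -[g x]; rewrite dbl_oneE tens_sumr linear_sum /=.
  under eq_bigr do rewrite !DE mulg1.
  rewrite (@sum_delta _ (x^-1 * g * x)%g _ (fun=> bas (g, x))) // => u.
  exact: eq_conjC.
- apply: hom_basP => -[g x]; rewrite !DE !linear_sum /=.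
  under eq_bigr do rewrite !DE tens_suml linear_sum /=.
  under [RHS]eq_bigr do rewrite !DE tens_sumr /=.
  rewrite [RHS]exchange_big /=; apply: eq_bigr => u _.
  rewrite [RHS](reindex_inj (mulgI u)) /=; apply: eq_bigr => v _.
  by rewrite !DE invMg mulKg mulgA.
- apply: hom_basP => -[g x]; rewrite !DE linear_sum /=.
  under eq_bigr do rewrite lextE !DE /=.
  by rewrite (@sum_delta _ g _ (fun u => bas (u, x))) // => u; rewrite -eq_mulVg1.
- apply: hom_basP => -[g x]; rewrite !DE linear_sum /=.
  under eq_bigr do rewrite lextE !DE /=.
  by rewrite (@sum_delta _ 1%g _ (fun u => bas ((u^-1 * g)%g, x))) // invg1 mul1g.
- apply: hom_basP => -[[g x] [h y]].
  rewrite comp_lfunE dbl_mulE linearZ /= dbl_comulE !DE tens_suml.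
  rewrite !linear_sum /=.
  transitivity (\sum_(u : gT) \sum_(v : gT)
     (u == x * v * x^-1)%g%:R *: ((u^-1 * g == x * (v^-1 * h) * x^-1)%g%:R *:
       (bas (((u^-1 * g)%g, (x * y)%g), (u, (x * y)%g))
         : vsp k ((G * G) * (G * G))%type))); last first.
    apply: eq_bigr => u _; rewrite tens_sumr !linear_sum /=.
    apply: eq_bigr => v _; rewrite !DE tensZl tensZr !DE.
    by rewrite !scalerA mulrC.
  apply: eq_bigr => u _; rewrite /=.
  rewrite (@sum_delta _ (x^-1 * u * x)%g _
     (fun v => (u^-1 * g == x * (v^-1 * h) * x^-1)%g%:R *: _)).
    rewrite !invMg invgK !mulgA mulgV mul1g -!mulgA (inj_eq (mulgI _)).
    by rewrite !mulgA.
  move=> v.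
  exact: eq_conjC.
- rewrite {1}dbl_oneE {2}dbl_oneE linear_sum tens_sumr /=.
  under eq_bigr do rewrite DE; rewrite dbl_oneE.
  under [RHS]eq_bigr do rewrite tens_suml.
  rewrite exchange_big /=; apply: eq_bigr => u _.
  rewrite (reindex_inj (mulgI u)) /=; apply: eq_bigr => v _.
  by rewrite mulKg DE.
- apply: counitM_on_bas => -[g x] [h y]; rewrite !DE linearZ /= !DE.
  rewrite -[_ *: _]/(_ * _) -!natrM !mulnb; congr (nat_of_bool _)%:R.
  case: (g =P 1%g) => [->|]; rewrite ?andbF //= andbT.
  by rewrite eq_sym conj_eq1.
- rewrite dbl_oneE linear_sum /= (bigD1 1%g) //= DE eqxx big1 ?addr0 //.
  by move=> g /negPf g1; rewrite DE g1.
- apply: eq_on_bas => -[g x].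
  rewrite !DE dbl_oneE linear_sum scaler_sumr !linear_sum /=.
  rewrite [RHS](reindex_inj (conjg_inj x)) /=.
  apply: eq_bigr => u _; rewrite !DE mulVg invMg !invgK /conjg !mulgA.
  rewrite !(inj_eq (mulIg _)) -[X in _ == X]mulg1 -!mulgA (inj_eq (mulgI _)).
  rewrite eq_invg1.
  by case: eqP => [->|_]; rewrite ?scale0r // invg1 mul1g.
- apply: eq_on_bas => -[g x].
  rewrite !DE dbl_oneE linear_sum scaler_sumr !linear_sum /=.
  rewrite [RHS](reindex_inj (@invg_inj _)) /=.
  apply: eq_bigr => u _; rewrite !DE mulgV !mulgA mulgV mul1g mulgK.
  rewrite -[X in _ == X]mulg1 (inj_eq (mulgI _)).
  by case: eqP => [->|_]; rewrite ?scale0r // mulg1.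
Defined.

End DrinfeldDouble.

Section HopfAut.
Variables (k : fieldType) (B : finType) (H : hopf_alg k B).
Implicit Types f g : 'End(vsp k B).

Lemma tmap_id : tmap \1 \1 = \1%VF :> 'End(vsp k (B * B)%type).
Proof. by apply: hom_basP => -[b c]; rewrite tmap_bas !id_lfunE tens_bas. Qed.

Lemma tmap_tens (C D E : finType) (f : 'Hom(vsp k B, vsp k D))
    (g : 'Hom(vsp k C, vsp k E)) x y :
  tmap f g (tens x y) = tens (f x) (g y).
Proof.
rewrite (bas_sum x) (bas_sum y) tens_suml !linear_sum tens_suml.
apply: eq_bigr => b _; rewrite !tens_sumr !linear_sum.
apply: eq_bigr => c _ /=.
by rewrite tensZl tensZr !linearZ /= tens_bas tmap_bas tensZl tensZr.
Qed.

Lemma tmap_comp f g :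
  tmap (f \o g) (f \o g) = (tmap f f \o tmap g g)%VF.
Proof.
by apply: hom_basP => -[b c]; rewrite comp_lfunE !tmap_bas tmap_tens !comp_lfunE.
Qed.

Definition is_hopf_aut f : Prop := hopf_mor H H f /\ bijective f.

Lemma is_hopf_aut1 : is_hopf_aut \1.
Proof.
split; last by exists id => x; rewrite id_lfunE.
by split=> [x y||x|x|x]; rewrite ?tmap_id !id_lfunE.
Qed.

Lemma is_hopf_autM f g : is_hopf_aut f -> is_hopf_aut g -> is_hopf_aut (f \o g).
Proof.
move=> [[fM f1 fc fe fs] fb] [[gM g1 gc ge gs] gb]; split; last first.
  by apply: (eq_bij (bij_comp fb gb)) => x; rewrite comp_lfunE.
split=> [x y||x|x|x]; rewrite ?tmap_comp !comp_lfunE ?gM ?fM ?g1 ?f1 //.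
- by rewrite fc gc.
- by rewrite fe ge.
- by rewrite gs fs.
Qed.

Lemma is_hopf_aut_ker f : is_hopf_aut f -> lker f == 0%VS.
Proof. by case=> _ /bij_inj fi; apply/lker0P. Qed.

Lemma is_hopf_autV f : is_hopf_aut f -> is_hopf_aut f^-1.
Proof.
move=> fa; have k0 := is_hopf_aut_ker fa.
have fK := lker0_lfunK k0; have fVK := lker0_lfunVK k0.
case: fa => [[fM f1 fc fe fs] fb]; split; last by exists f.
split=> [x y||x|x|x].
- by rewrite -{1}(fVK x) -{1}(fVK y) -fM fK.
- by rewrite -f1 fK.
- have /= := congr1 (fun F : 'End(_) => F (hcomul H (f^-1%VF x)))
    (tmap_comp f^-1 f).
  by rewrite lker0_compVf // tmap_id id_lfunE comp_lfunE -fc fVK.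
- by rewrite -fe fVK.
- by rewrite -{1}(fVK x) -fs fK.
Qed.

Record hopf_aut := HopfAut {
  hopf_aut_val :> 'End(vsp k B);
  _ : `[< is_hopf_aut hopf_aut_val >]
}.
HB.instance Definition _ := [isSub for hopf_aut_val].
HB.instance Definition _ := [Choice of hopf_aut by <:].

Lemma hopf_autP (f : hopf_aut) : is_hopf_aut f.
Proof. exact/asboolP/(valP f). Qed.

Definition haut_one := HopfAut (asboolT is_hopf_aut1).
Definition haut_mul (f g : hopf_aut) :=
  HopfAut (asboolT (is_hopf_autM (hopf_autP f) (hopf_autP g))).
Definition haut_inv (f : hopf_aut) :=
  HopfAut (asboolT (is_hopf_autV (hopf_autP f))).

Fact haut_mulA : associative haut_mul.
Proof. by move=> f g h; apply/val_inj/comp_lfunA. Qed.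
Fact haut_mul1 : left_id haut_one haut_mul.
Proof. by move=> f; apply/val_inj/comp_lfun1l. Qed.
Fact haut_mulr1 : right_id haut_one haut_mul.
Proof. by move=> f; apply/val_inj/comp_lfun1r. Qed.
Fact haut_mulV : left_inverse haut_one haut_inv haut_mul.
Proof.
by move=> f; apply/val_inj/lker0_compVf/is_hopf_aut_ker/hopf_autP.
Qed.
Fact haut_mulrV : right_inverse haut_one haut_inv haut_mul.
Proof.
by move=> f; apply/val_inj/lker0_compfV/is_hopf_aut_ker/hopf_autP.
Qed.
HB.instance Definition _ := isGroup.Build hopf_aut
  haut_mulA haut_mul1 haut_mulr1 haut_mulV haut_mulrV.

End HopfAut.

Section CenterEnd.
Variable gT : finGroupType.
Local Open Scope group_scope.

Definition zgrp : finGroupType := subg_of 'Z([set: gT])%G.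

Lemma zgrpC (x y : zgrp) : x * y = y * x.
Proof.
apply: val_inj => /=; have /centerP[_ ] := subgP x; apply; exact: in_setT.
Qed.

(* End(Z(G)), a group for the pointwise product. *)
Record cend := CEnd {
  cend_val :> {ffun zgrp -> zgrp};
  _ : morphic [set: zgrp] cend_val
}.
HB.instance Definition _ := [isSub for cend_val].
HB.instance Definition _ := [Choice of cend by <:].

Lemma cendM (f : cend) : {morph f : x y / x * y}.
Proof. by move=> x y; apply: (morphicP (valP f)); rewrite in_setT. Qed.

Fact cend_one_morphic : morphic [set: zgrp] [ffun=> 1 : zgrp].
Proof. by apply/morphicP => x y _ _; rewrite !ffunE mulg1. Qed.
Fact cend_mul_morphic (f g : cend) :
  morphic [set: zgrp] [ffun x => f x * g x].
Proof.
apply/morphicP => x y _ _; rewrite !ffunE !cendM -!mulgA.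
by congr (_ * _); rewrite !mulgA (zgrpC (f y)).
Qed.
Fact cend_inv_morphic (f : cend) : morphic [set: zgrp] [ffun x => (f x)^-1].
Proof. by apply/morphicP => x y _ _; rewrite !ffunE cendM zgrpC invMg. Qed.

Definition cend_one := CEnd cend_one_morphic.
Definition cend_mul (f g : cend) := CEnd (cend_mul_morphic f g).
Definition cend_inv (f : cend) := CEnd (cend_inv_morphic f).

Fact cend_mulA : associative cend_mul.
Proof. by move=> f g h; apply/val_inj/ffunP => x; rewrite !ffunE mulgA. Qed.
Fact cend_mul1 : left_id cend_one cend_mul.
Proof. by move=> f; apply/val_inj/ffunP => x; rewrite !ffunE mul1g. Qed.
Fact cend_mulr1 : right_id cend_one cend_mul.
Proof. by move=> f; apply/val_inj/ffunP => x; rewrite !ffunE mulg1. Qed.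
Fact cend_mulV : left_inverse cend_one cend_inv cend_mul.
Proof. by move=> f; apply/val_inj/ffunP => x; rewrite !ffunE mulVg. Qed.
Fact cend_mulrV : right_inverse cend_one cend_inv cend_mul.
Proof. by move=> f; apply/val_inj/ffunP => x; rewrite !ffunE mulgV. Qed.
HB.instance Definition _ := isGroup.Build cend
  cend_mulA cend_mul1 cend_mulr1 cend_mulV cend_mulrV.

End CenterEnd.

Section Lambda.
Variables (k : fieldType) (gT : finGroupType).
Local Notation G := (gT : finType).
Local Notation DG := (drinfeld_double k gT).
Local Notation kdual := (dual_cop k gT).
Local Notation kG := (group_algebra k gT).

(* psi_p : a # g |-> a_(1) # p(a_(2)) g.  The Sweedler sum is the coordinate
   expansion of the coproduct of a in (k^G)^cop. *)
Definition has_psi_form (p : 'Hom(vsp k G, vsp k G))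
    (f : 'End(vsp k (G * G)%type)) : Prop :=
  forall (a : vsp k G) (g : gT),
    f (tens a (bas g)) =
    \sum_(q : gT * gT) (hcomul kdual a q : k) *:
      tens (bas q.1) (hprod kG (p (bas q.2)) (bas g)).

Definition Lambda : {pred hopf_aut DG} :=
  fun f => `[< exists p, hopf_mor kdual kG p /\ has_psi_form p f >].

End Lambda.

Arguments Lambda : clear implicits.

(* Main.v *)
(** Write [P u w] for the coefficient of [w] in [p e_u].  Then
    [psi_p (e_g # x)] has coefficient [P (g c^-1) (d x^-1)] at [e_c # d], and
    [p] is a Hopf map exactly when the rows and the columns of [P] are
    orthogonal idempotents for convolution, with the right sums.

    Compatibility of [psi_p] with the two multiplications and coproducts makes
    [P] a class function of each variable; since distinct rows (and columns)
    are orthogonal, [P] then vanishes off [Z(G) x Z(G)].  Conversely every such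
    [P] supported on [Z(G) x Z(G)] gives a Hopf automorphism, and composition of
    the [psi_p] is convolution of the [P].

    Finally fix a nondegenerate symmetric pairing [beta] of [Z(G)] with values
    in [k^*]; it exists because [Z(G)] is a product of cyclic groups and [k] has
    enough roots of unity.  The Fourier transform along [beta] of [P] in its
    first variable takes grouplike values in [k Z(G)], that is, it is an
    endomorphism of [Z(G)]. *)

Require Import Defs.
From mathcomp Require Import all_boot all_order all_algebra all_fingroup.
From HB Require Import structures.
From mathcomp Require Import cyclic center abelian separable cyclotomic boolp.
From mathcomp Require Import ring.

Import GRing.Theory.
Local Open Scope group_scope.

Set Implicit Arguments.
Unset Strict Implicit.

(** * Coordinates of the structure maps *)

(** Collapses a sum over pairs to its one free coordinate: the second hypothesis says that [F]
    vanishes off the image of [h]. *)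
Lemma sum_image {R : nmodType} {I J : finType} (h : I -> J) (h' : J -> I)
    (F : J -> R) :
  cancel h h' -> (forall j, h (h' j) != j -> F j = 0%R) ->
  (\sum_j F j = \sum_i F (h i))%R.
Proof.
move=> hK F0; rewrite (bigID (fun j => h (h' j) == j)) /= addrC big1 // add0r.
rewrite (reindex_onto h h') => [|j /eqP //]; apply: eq_bigl => i.
by rewrite !hK !eqxx.
Qed.

Section Coordinates.
Variable k : fieldType.
Local Open Scope ring_scope.

Lemma basE (B : finType) (b c : B) : (bas b : vsp k B) c = (c == b)%:R.
Proof. by rewrite ffunE. Qed.

Lemma scale_basE (B : finType) (a : k) (b c : B) :
  (a *: bas b : vsp k B) c = a * (c == b)%:R.
Proof. by rewrite !ffunE. Qed.

Lemma tensE (B C : finType) (x : vsp k B) (y : vsp k C) b c :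
  tens x y (b, c) = (x b : k) * y c.
Proof. by rewrite ffunE. Qed.

Lemma coord_lin (B C : finType) (L : 'Hom(vsp k B, vsp k C)) v c :
  L v c = \sum_b (v b : k) * L (bas b) c.
Proof.
rewrite {1}(bas_sum v) linear_sum sum_ffunE; apply: eq_bigr => b _.
by rewrite linearZ /= ffunE.
Qed.

Lemma coord_lin2 (A B C : finType) (L : 'Hom(vsp k (A * B)%type, vsp k C)) v c :
  L v c = \sum_a \sum_b (v (a, b) : k) * L (bas (a, b)) c.
Proof. by rewrite coord_lin pair_bigA; apply: eq_bigr => -[]. Qed.

Lemma form_lin (B : finType) (L : 'Hom(vsp k B, k^o)) v :
  L v = \sum_b (v b : k) * L (bas b).
Proof.
by rewrite {1}(bas_sum v) linear_sum; apply: eq_bigr => b _; rewrite linearZ.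
Qed.

Lemma morM_on_bas (B C : finType) (H : hopf_alg k B) (K : hopf_alg k C)
    (f : 'Hom(vsp k B, vsp k C)) :
  (forall b c, f (hprod H (bas b) (bas c)) = hprod K (f (bas b)) (f (bas c))) ->
  {morph f : x y / hprod H x y >-> hprod K x y}.
Proof.
move=> fM x y; have E : (f \o hmul H = hmul K \o tmap f f)%VF.
  apply: hom_basP => -[b c]; rewrite !comp_lfunE tmap_bas -tens_bas.
  exact: fM.
by have /lfunP/(_ (tens x y)) := E; rewrite !comp_lfunE tmap_tens.
Qed.

Lemma tmap_sum_bas (I B C : finType) (f : 'Hom(vsp k B, vsp k C))
    (h1 h2 : I -> B) c d :
  tmap f f (\sum_i bas (h1 i, h2 i)) (c, d) =
    \sum_i (f (bas (h1 i)) c : k) * f (bas (h2 i)) d.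
Proof.
rewrite linear_sum sum_ffunE; apply: eq_bigr => i _.
by rewrite /= tmap_bas tensE.
Qed.

Variable gT : finGroupType.
Local Notation G := (gT : finType).
Local Notation DG := (drinfeld_double k gT).
Local Notation kdual := (dual_cop k gT).
Local Notation kG := (group_algebra k gT).
Implicit Types (c d g h x y : gT).

Lemma kG_prodE (v w : vsp k G) d :
  hprod kG v w d = \sum_y (v y : k) * w (y^-1 * d)%g.
Proof.
rewrite coord_lin (@sum_image _ _ _ (fun y => (y, y^-1 * d)%g) fst) => //=
  [|[y z]] /=.
  by apply: eq_bigr => y _; rewrite tensE kG_mulE basE mulKVg eqxx mulr1.
move=> yz; rewrite kG_mulE basE; case: eqP => [dE|]; last by rewrite mulr0.
by case/eqP: yz; rewrite dE mulKg.
Qed.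

(** The first factor must be [e_c # y]; the commutation rule of the double then forces the second to
    be [e_(c ^ y) # y^-1 d]. *)
Lemma dbl_prodE (v w : vsp k (G * G)%type) c d :
  hprod DG v w (c, d) =
    \sum_y (v (c, y) : k) * w (c ^ y, y^-1 * d)%g.
Proof.
rewrite coord_lin
  (@sum_image _ _ _ (fun y => ((c, y), (c ^ y, y^-1 * d)%g))
    (fun b => b.1.2)) => //.
  apply: eq_bigr => y _; rewrite tensE dbl_mulE scale_basE conjgE.
  by rewrite !mulgA mulgV !mul1g mulgK !eqxx !mulr1.
move=> [[g y] [h z]] /= neq; rewrite dbl_mulE scale_basE.
rewrite -natrM mulnb; case: andP => [[/eqP gE]|_]; last by rewrite mulr0.
rewrite xpair_eqE => /andP[/eqP cg /eqP dE]; case/eqP: neq.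
by rewrite cg dE mulKg gE conjgE mulgKV mulKg.
Qed.

Lemma kG_oneE d : hone kG d = (d == 1%g)%:R.
Proof. exact: basE. Qed.

Lemma dual_oneE g : hone kdual g = 1.
Proof.
rewrite /= /dual_one sum_ffunE (bigD1 g) //= basE eqxx big1 ?addr0 // => h.
by rewrite basE eq_sym => /negPf->.
Qed.

Lemma dbl_one_coord c d : hone DG (c, d) = (d == 1%g)%:R.
Proof. by rewrite [LHS]tensE -/(hone kdual) dual_oneE basE mul1r. Qed.

Lemma kG_counit_sum (v : vsp k G) : hcounit kG v = \sum_y v y.
Proof.
by rewrite form_lin; apply: eq_bigr => y _; rewrite kG_counitE mulr1.
Qed.

Lemma dual_counit_at1 (v : vsp k G) : hcounit kdual v = v 1%g.
Proof.
rewrite form_lin (bigD1 1%g) //= dual_counitE eqxx mulr1 big1 ?addr0 // => y.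
by rewrite dual_counitE => /negPf->; rewrite mulr0.
Qed.

Lemma dbl_counit_sum (v : vsp k (G * G)%type) :
  hcounit DG v = \sum_y v (1%g, y).
Proof.
rewrite form_lin (@sum_image _ _ _ (fun y => (1%g, y)) snd) => [|//|[c y]] /=.
  by apply: eq_bigr => y _; rewrite dbl_counitE eqxx mulr1.
by rewrite xpair_eqE eqxx andbT eq_sym dbl_counitE => /negPf->; rewrite mulr0.
Qed.

Lemma kG_comul_coord (v : vsp k G) a b :
  hcomul kG v (a, b) = (a == b)%:R * (v a : k).
Proof.
rewrite coord_lin (bigD1 a) //= kG_comulE basE xpair_eqE eqxx eq_sym mulrC.
rewrite big1 ?addr0 // => c; rewrite kG_comulE basE xpair_eqE eq_sym => /negPf->.
by rewrite mulr0.
Qed.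

Lemma dual_comul_bas_coord g c d :
  hcomul kdual (bas g) (c, d) = (g == d * c)%g%:R.
Proof.
rewrite /= dual_comulE sum_ffunE (bigD1 d) //= basE xpair_eqE eqxx andbT big1.
  by rewrite addr0 -(inj_eq (mulgI d)) mulKVg eq_sym.
by move=> u; rewrite basE xpair_eqE eq_sym => /negPf->; rewrite andbF.
Qed.

(** On functions the coproduct is evaluation at a product; the order [d * c] comes from the
    co-opposite. *)
Lemma dual_comul_coord (v : vsp k G) c d :
  hcomul kdual v (c, d) = v (d * c)%g.
Proof.
rewrite coord_lin (bigD1 (d * c)%g) //= dual_comul_bas_coord eqxx mulr1.
rewrite big1 ?addr0 // => g /negPf; rewrite dual_comul_bas_coord => ->.
by rewrite mulr0.
Qed.

Lemma dbl_comul_bas_coord g x c a d b :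
  hcomul DG (bas (g, x)) ((c, a), (d, b)) =
    (a == b)%:R * ((d * c)%g == g)%:R * (a == x)%:R.
Proof.
rewrite [hcomul DG]/= dbl_comulE sum_ffunE (bigD1 d) //= basE !xpair_eqE eqxx big1.
  rewrite addr0 -(inj_eq (mulgI d)) mulKVg /= -!natrM !mulnb.
  congr (nat_of_bool _)%:R; rewrite [RHS]andbC [LHS]andbAC -andbA.
  case: (a =P x) => [->|_]; last by rewrite !andbF.
  by rewrite !andbT /= andbC eq_sym.
by move=> u; rewrite basE !xpair_eqE (eq_sym d) => /negPf->; rewrite andbF.
Qed.

Lemma dbl_comul_coord (v : vsp k (G * G)%type) c a d b :
  hcomul DG v ((c, a), (d, b)) = (a == b)%:R * (v (d * c, a)%g : k).
Proof.
rewrite coord_lin (bigD1 (d * c, a)%g) //= dbl_comul_bas_coord !eqxx !mulr1.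
rewrite mulrC big1 ?addr0 // => -[g x]; rewrite xpair_eqE (eq_sym g) (eq_sym x).
rewrite dbl_comul_bas_coord -mulrA -natrM mulnb => /negPf->.
by rewrite !mulr0.
Qed.

Lemma kG_anti_coord (v : vsp k G) d : hanti kG v d = v (d^-1)%g.
Proof.
rewrite coord_lin (bigD1 (d^-1)%g) //= kG_antiE basE invgK eqxx mulr1 big1.
  by rewrite addr0.
by move=> g; rewrite kG_antiE basE -(inj_eq invg_inj) invgK eq_sym => /negPf->;
  rewrite mulr0.
Qed.

Lemma dual_anti_coord (v : vsp k G) d : hanti kdual v d = v (d^-1)%g.
Proof. exact: kG_anti_coord. Qed.

Lemma dbl_anti_coord (v : vsp k (G * G)%type) c d :
  hanti DG v (c, d) = v ((c^-1) ^ d, d^-1)%g.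
Proof.
rewrite coord_lin (bigD1 ((c^-1) ^ d, d^-1)%g) //= dbl_antiE basE invgK.
rewrite conjgE !invMg !invgK !mulgA mulgV mul1g mulgK eqxx mulr1.
rewrite big1 ?addr0 // => -[g x]; rewrite dbl_antiE basE !xpair_eqE => neq.
case: andP => [[/eqP cE /eqP dE]|_]; last by rewrite mulr0.
case/negP: neq; rewrite cE dE !invMg !invgK.
by rewrite !mulgA mulgV mul1g mulgK !eqxx.
Qed.

End Coordinates.

(** * Hopf maps from [k^G] to [kG] as matrices *)

Section HopfMatrices.
Variables (k : fieldType) (gT : finGroupType).
Local Open Scope ring_scope.
Local Notation G := (gT : finType).
Local Notation DG := (drinfeld_double k gT).
Local Notation kdual := (dual_cop k gT).
Local Notation kG := (group_algebra k gT).
Implicit Types (P Q : gT -> gT -> k) (g h u v w x y a b c d : gT).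

Definition mat_hom P : 'Hom(vsp k G, vsp k G) :=
  lext (fun u => ([ffun w => P u w : k^o] : vsp k G)).

Lemma mat_homE P u w : mat_hom P (bas u) w = P u w.
Proof. by rewrite lextE ffunE. Qed.

(** [e_g # x] goes to the sum over [u] of [e_(u^-1 g) # p(e_u) x]; solving [c = u^-1 g] gives the
    first index. *)
Definition psi_mat P : 'End(vsp k (G * G)%type) :=
  lext (fun gx : gT * gT =>
    ([ffun cd : gT * gT => P (gx.1 * cd.1^-1)%g (cd.2 * gx.2^-1)%g : k^o]
      : vsp k (G * G)%type)).

Lemma psi_matE P g x c d :
  psi_mat P (bas (g, x)) (c, d) = P (g * c^-1)%g (d * x^-1)%g.
Proof. by rewrite lextE ffunE. Qed.

Lemma kG_prod_bas (v : vsp k G) x d : hprod kG v (bas x) d = v (d * x^-1)%g.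
Proof.
rewrite kG_prodE (bigD1 (d * x^-1)%g) //= basE invMg invgK mulgKV eqxx mulr1.
rewrite big1 ?addr0 // => y yd; rewrite basE; case: eqP => [xE|_]; last first.
  by rewrite mulr0.
by case/eqP: yd; rewrite -xE invMg invgK mulKVg.
Qed.

(** Both sides have coefficient [\sum_u a (u * c) * p (bas u) (d * x^-1)] at [(c, d)], and a linear
    map is determined on the vectors [tens (bas g) (bas x)]. *)
Lemma has_psi_formP (p : 'Hom(vsp k G, vsp k G)) (f : 'End(vsp k (G * G)%type)) :
  has_psi_form p f <-> f = psi_mat (fun u w => p (bas u) w).
Proof.
pose rhs (a : vsp k G) x : vsp k (G * G)%type := \sum_(q : gT * gT)
  (hcomul kdual a q : k) *: tens (bas q.1) (hprod kG (p (bas q.2)) (bas x)).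
have rhsE (a : vsp k G) x c d : rhs a x (c, d) =
    \sum_u (a (u * c)%g : k) * p (bas u) (d * x^-1)%g.
  rewrite sum_ffunE (@sum_image _ _ _ (fun u => (c, u)) snd) => [|//|[c' u]] /=.
    apply: eq_bigr => u _; rewrite ffunE tensE basE eqxx mul1r kG_prod_bas.
    by rewrite dual_comul_coord.
  rewrite xpair_eqE eqxx andbT => /negPf cc; rewrite ffunE tensE basE cc.
  by rewrite mul0r [LHS]mulr0.
have psiE (a : vsp k G) x c d :
    psi_mat (fun u w => p (bas u) w) (tens a (bas x)) (c, d) =
    \sum_u (a (u * c)%g : k) * p (bas u) (d * x^-1)%g.
  rewrite coord_lin (@sum_image _ _ _ (fun g => (g, x)) fst) => [|//|[g y]] /=.
    rewrite (reindex_inj (mulIg c)); apply: eq_bigr => u _.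
    by rewrite tensE basE eqxx mulr1 psi_matE mulgK.
  by rewrite xpair_eqE eqxx /= eq_sym tensE basE => /negPf->; rewrite mulr0 mul0r.
split=> [pf|-> a x]; last by apply/ffunP => -[c d]; rewrite psiE -rhsE.
apply: hom_basP => -[g x]; rewrite -tens_bas pf; apply/ffunP => -[c d].
by rewrite psiE -rhsE.
Qed.

(** These are the bialgebra conditions on [p], read on coefficients. The antipode condition is
    [P u^-1 w = P u w^-1], stated separately where a Hopf map is built. *)
Record hopf_mat P : Prop := HopfMat {
  hmat_comul : forall g a b,
    \sum_u P (u^-1 * g)%g a * P u b = (a == b)%:R * P g a;
  hmat_mul : forall g h w,
    \sum_y P g y * P h (y^-1 * w)%g = (g == h)%:R * P g w;
  hmat_counit : forall g, \sum_w P g w = (g == 1%g)%:R;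
  hmat_unit : forall w, \sum_g P g w = (w == 1%g)%:R
}.

Lemma dual_prod_bas g h : hprod kdual (bas g) (bas h) = (g == h)%:R *: bas g.
Proof. by rewrite /hprod tens_bas; exact: dual_mulE. Qed.

Lemma hopf_mor_mat (p : 'Hom(vsp k G, vsp k G)) :
  hopf_mor kdual kG p -> hopf_mat (fun u w => p (bas u) w).
Proof.
move=> [pM p1 pD pe _]; split=> [g a b|g h w|g|w].
- have /ffunP/(_ (a, b)) := pD (bas g).
  by rewrite kG_comul_coord dual_comulE tmap_sum_bas => ->.
- rewrite -kG_prodE -pM dual_prod_bas.
  by rewrite linearZ ffunE.
- by rewrite -kG_counit_sum pe dual_counit_at1 basE eq_sym.
- rewrite -kG_oneE -p1 coord_lin; apply: eq_bigr => g _.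
  by rewrite dual_oneE mul1r.
Qed.

Lemma mat_hopf_mor P : hopf_mat P -> (forall u w, P u^-1%g w = P u w^-1%g) ->
  hopf_mor kdual kG (mat_hom P).
Proof.
move=> [P1 P2 P3 P4] PV; split=> [||v|v|v].
- apply: morM_on_bas => g h; apply/ffunP => w; rewrite kG_prodE.
  rewrite dual_prod_bas linearZ ffunE mat_homE; under eq_bigr do rewrite !mat_homE.
  by rewrite P2.
- apply/ffunP => w; rewrite kG_oneE coord_lin -P4; apply: eq_bigr => g _.
  by rewrite dual_oneE mat_homE mul1r.
- have E : (hcomul kG \o mat_hom P = tmap (mat_hom P) (mat_hom P) \o hcomul kdual)%VF.
    apply: hom_basP => g; apply/ffunP => -[a b]; rewrite !comp_lfunE.
    rewrite kG_comul_coord mat_homE -P1 dual_comulE tmap_sum_bas.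
    by apply: eq_bigr => u _; rewrite !mat_homE.
  by have /lfunP/(_ v) := E; rewrite !comp_lfunE.
- rewrite kG_counit_sum dual_counit_at1; under eq_bigr do rewrite coord_lin.
  rewrite exchange_big (bigD1 1%g) //= [X in _ + X]big1 => [|g g1].
    rewrite addr0 -mulr_sumr; under eq_bigr do rewrite mat_homE.
    by rewrite P3 eqxx mulr1.
  rewrite -mulr_sumr; under eq_bigr do rewrite mat_homE.
  by rewrite P3 (negPf g1) mulr0.
- apply/ffunP => w; rewrite kG_anti_coord [LHS]coord_lin [RHS]coord_lin.
  rewrite (reindex_inj (@invg_inj gT)).
  by apply: eq_bigr => u _; rewrite dual_anti_coord !mat_homE invgK -PV.
Qed.

(** * Class functions and central support *)

Definition central_mat P :=
  forall u w, P u w != 0 -> (u \in 'Z([set: gT])) && (w \in 'Z([set: gT])).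

Lemma centralM u : u \in 'Z([set: gT]) -> forall x, (u * x = x * u)%g.
Proof. by case/centerP => _ uC x; apply: uC; rewrite inE. Qed.

Lemma centralPn w : w \notin 'Z([set: gT]) -> exists x, (w ^ x != w)%g.
Proof.
move=> wZ; have [x xw|wC] := pickP (fun x => w ^ x != w)%g; first by exists x.
case/negP: wZ; apply/centerP; split=> [|x _]; first by rewrite inE.
by apply/commgP/conjg_fixP/eqP/negbFE/wC.
Qed.

(** A row shared by two distinct conjugates is both idempotent and orthogonal to itself, hence zero;
    likewise for columns. *)
Lemma class_central_mat P : hopf_mat P ->
  (forall u w x, P (u ^ x)%g w = P u w) ->
  (forall u w x, P u (w ^ x)%g = P u w) ->
  central_mat P.
Proof.
move=> [P1 P2 _ _] Pu Pw u w; apply: contraR; rewrite negb_and => /orP[] /centralPn[x].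
  move=> ux; have := P2 u (u ^ x)%g w; rewrite eq_sym (negPf ux) mul0r => <-.
  by under eq_bigr do rewrite Pu; rewrite P2 eqxx mul1r.
move=> wx; have := P1 u w (w ^ x)%g; rewrite eq_sym (negPf wx) mul0r => <-.
by under eq_bigr do rewrite Pw; rewrite P1 eqxx mul1r.
Qed.

(** The sum is the grouplike element [ε # x], so multiplying by it on the left only permutes
    coordinates. *)
Lemma dbl_prod_grouplike x (v : vsp k (G * G)%type) c d :
  hprod DG (\sum_h bas (h, x)) v (c, d) = v (c ^ x, x^-1 * d)%g.
Proof.
rewrite dbl_prodE (bigD1 x) //= sum_ffunE (bigD1 c) //= basE eqxx.
rewrite big1 => [|h]; last by rewrite basE xpair_eqE eq_sym => /negPf->.
rewrite addr0 mul1r big1 ?addr0 // => y /negPf yx.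
by rewrite sum_ffunE big1 ?mul0r // => h _; rewrite basE xpair_eqE yx andbF.
Qed.

Lemma dbl_grouplike_bas x g :
  hprod DG (\sum_h bas (h, x)) (bas (g, 1%g)) = bas (g ^ x^-1, x)%g.
Proof.
apply/ffunP => -[c d]; rewrite dbl_prod_grouplike !basE !xpair_eqE.
rewrite -(inj_eq (conjg_inj x) c) conjgKV -(inj_eq (mulgI x) (x^-1 * d)%g).
by rewrite mulKVg mulg1.
Qed.

(** [ε] is grouplike and [p] sends it to 1, so [ε # x] is fixed. *)
Lemma psi_mat_grouplike P x : hopf_mat P ->
  psi_mat P (\sum_h bas (h, x)) = \sum_h bas (h, x).
Proof.
move=> [_ _ _ P4]; apply/ffunP => -[c d]; rewrite linear_sum !sum_ffunE.
under eq_bigr do rewrite psi_matE; rewrite [LHS](reindex_inj (mulIg c)) /=.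
under eq_bigr do rewrite mulgK; rewrite P4 (bigD1 c) //= basE xpair_eqE eqxx /=.
rewrite big1 => [|h]; last by rewrite basE xpair_eqE eq_sym => /negPf->.
by rewrite addr0 -eq_mulgV1.
Qed.

Lemma psi_mat_class P : hopf_mat P -> hopf_mor DG DG (psi_mat P) ->
  (forall u w x, P (u ^ x)%g w = P u w) /\ (forall u w x, P u (w ^ x)%g = P u w).
Proof.
move=> Pm [fM _ fD _ _]; have [P1 P2 P3 P4] := Pm.
have PC g d a : P (d * g)%g a = P (g * d)%g a.
  pose Q s := P (d * s)%g a - P (s * d)%g a.
  suff: Q g = 0 by move/eqP; rewrite subr_eq0 => /eqP.
  (* The coproduct of [psi (e_g # 1)] and [hmat_comul] give two sums for
     [(a == b)%:R * P (g * d) a]; this is their difference. *)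
  have Q0 b : \sum_s Q (s^-1 * g)%g * P s b = 0.
    have /ffunP/(_ ((1, a), (d^-1, b))%g) := fD (bas (g, 1%g)).
    rewrite dbl_comul_coord psi_matE /= dbl_comulE tmap_sum_bas invg1 !mulg1 invgK.
    rewrite -P1 => E; transitivity (\sum_s P (d * s^-1 * g)%g a * P s b
        - \sum_s P (s^-1 * (g * d))%g a * P s b).
      by rewrite -sumrB; apply: eq_bigr => s _; rewrite -mulrBl /Q !mulgA.
    rewrite E (reindex_inj (mulIg d)) -sumrB big1 // => s _.
    by rewrite !psi_matE invg1 invgK !mulg1 invMg mulKVg subrr.
  (* Summed over [b], the counit condition turns [P s b] into a delta at [s = 1], which isolates
     [Q g]. *)
  have : \sum_b \sum_s Q (s^-1 * g)%g * P s b = 0 by exact: big1.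
  rewrite exchange_big /= (bigD1 1%g) //= -mulr_sumr P3 eqxx mulr1 invg1 mul1g.
  rewrite big1 ?addr0 // => s /negPf s1; rewrite -mulr_sumr P3 s1 mulr0 //.
have Pu u w x : P (u ^ x)%g w = P u w by rewrite conjgE PC mulgK.
split=> // u w x.
(* Apply [psi] to [(ε # x)(e_(u ^ x) # 1) = e_u # x], whose first factor is fixed. At
   [d = x * w ^ x = w * x] the two sides read [P u w] and [P (u ^ x) (w ^ x)]. *)
have := fM (\sum_h bas (h, x)) (bas (u ^ x, 1%g)%g).
rewrite psi_mat_grouplike // dbl_grouplike_bas conjgK.
move/ffunP/(_ (1, x * w ^ x)%g); rewrite dbl_prod_grouplike !psi_matE.
by rewrite conj1g invg1 !mulg1 mulKg Pu {1}conjgE mulKVg mulgK => ->.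
Qed.

(** The convolution product of maps from [(k^G)^cop] to [kG]: the legs [s] and [u * s^-1] multiply
    to [u] in reversed order. *)
Definition mat_conv P Q u w := \sum_s \sum_y P s y * Q (u * s^-1)%g (y^-1 * w)%g.

Lemma psi_mat_comp P Q : (psi_mat P \o psi_mat Q)%VF = psi_mat (mat_conv P Q).
Proof.
apply: hom_basP => -[g x]; apply/ffunP => -[c d]; rewrite comp_lfunE.
rewrite coord_lin2 psi_matE /mat_conv.
rewrite (reindex_inj (mulIg c)); apply: eq_bigr => s _ /=.
rewrite (reindex_inj (@invg_inj gT)) (reindex_inj (mulgI d^-1%g)) /=.
apply: eq_bigr => y _; rewrite !psi_matE mulgK invgK mulKVg mulrC.
by rewrite !invMg invgK !mulgA.
Qed.

Lemma psi_mat_id P : (forall u w, P u w = (u == 1%g)%:R * (w == 1%g)%:R) ->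
  psi_mat P = \1%VF.
Proof.
move=> P1; apply: hom_basP => -[g x]; apply/ffunP => -[c d].
rewrite psi_matE P1 id_lfunE basE xpair_eqE -!eq_mulgV1 -natrM mulnb.
by rewrite (eq_sym g).
Qed.

(** * From central matrices to Hopf maps of the double *)

Lemma central_mulC u v : (u * v)%g \in 'Z([set: gT]) -> (u * v = v * u)%g.
Proof. by move=> /centralM/(_ u); rewrite -mulgA => /mulgI. Qed.

Lemma conjg_centralM t x c : t \in 'Z([set: gT]) -> (c ^ (t * x) = c ^ x)%g.
Proof. by move=> tZ; rewrite conjgM (conjgE c t) -(centralM tZ) mulKg. Qed.

(** If either product is central the two are equal; otherwise both entries vanish. *)
Lemma central_mat_swapl P : central_mat P ->
  forall u v w, P (u * v)%g w = P (v * u)%g w.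
Proof.
move=> PZ u v w; case uvZ: ((u * v)%g \in 'Z([set: gT])).
  by rewrite (central_mulC uvZ).
case vuZ: ((v * u)%g \in 'Z([set: gT])); first by rewrite (central_mulC vuZ).
have P0 s : s \notin 'Z([set: gT]) -> P s w = 0.
  by move=> sZ; apply/eqP/negPn/negP => /PZ; rewrite (negPf sZ).
by rewrite !P0 ?uvZ ?vuZ.
Qed.

Lemma central_mat_swapr P : central_mat P ->
  forall w u v, P w (u * v)%g = P w (v * u)%g.
Proof.
move=> PZ w u v; apply: (@central_mat_swapl (fun a b => P b a)) => a b.
by move/PZ; rewrite andbC.
Qed.

Lemma psi_mat_hopf_mor P : hopf_mat P -> central_mat P ->
  (forall u w, P u^-1%g w = P u w^-1%g) -> hopf_mor DG DG (psi_mat P).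
Proof.
move=> [P1 P2 P3 P4] PZ PV.
have Pl := central_mat_swapl PZ; have Pr := central_mat_swapr PZ.
have PJ u w x : P (u ^ x)%g w = P u w by rewrite conjgE Pl mulgK.
split=> [||v|v|v].
- apply: morM_on_bas => -[g x] [h y]; apply/ffunP => -[c d].
  have -> : hprod DG (bas (g, x)) (bas (h, y)) =
      (g == x * h * x^-1)%g%:R *: bas (g, (x * y)%g).
    by rewrite /hprod tens_bas [LHS]dbl_mulE.
  rewrite linearZ ffunE psi_matE dbl_prodE (reindex_inj (mulIg x)) /=.
  (* After the shift by [x] the product becomes a convolution of two rows, which [P2] evaluates. *)
  transitivity (\sum_t P (g * c^-1)%g t *
      P (h ^ x^-1 * c^-1)%g (t^-1 * (d * y^-1 * x^-1))%g).
    rewrite P2 (inj_eq (mulIg _)) conjgE invgK mulgA invMg mulgA.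
    by [].
  apply: eq_bigr => t _; rewrite !psi_matE mulgK.
  (* Only central [t] contribute, and for these conjugation by [t * x] is conjugation by [x]. *)
  have [->|/PZ/andP[_ tZ]] := eqVneq (P (g * c^-1)%g t) 0; first by rewrite !mul0r.
  rewrite conjg_centralM // (invMg t) -!(mulgA x^-1%g) [P _ (x^-1 * _)%g]Pr !mulgA.
  by rewrite -[P (h * _)%g _](PJ _ _ x^-1%g) conjMg conjVg conjgK.
- apply/ffunP => -[c d]; rewrite dbl_one_coord -P4.
  rewrite coord_lin (@sum_image _ _ _ (fun g => (g, 1%g)) fst) => [|//|[g y]] /=.
    rewrite (reindex_inj (mulIg c)); apply: eq_bigr => g _.
    by rewrite dbl_one_coord eqxx mul1r psi_matE mulgK invg1 mulg1.
  by rewrite xpair_eqE eqxx /= eq_sym dbl_one_coord => /negPf->; rewrite mul0r.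
- have E : (hcomul DG \o psi_mat P = tmap (psi_mat P) (psi_mat P) \o hcomul DG)%VF.
    apply: hom_basP => -[g x]; apply/ffunP => -[[c a] [d b]].
    rewrite comp_lfunE [in RHS]comp_lfunE.
    rewrite dbl_comul_coord psi_matE [hcomul DG _]dbl_comulE tmap_sum_bas.
    rewrite (reindex_inj (mulIg d)) /= invMg mulgA.
    transitivity (\sum_s P (s^-1 * (g * c^-1 * d^-1))%g (a * x^-1)%g
        * P s (b * x^-1)%g); first by rewrite P1 (inj_eq (mulIg _)).
    apply: eq_bigr => s _; rewrite !psi_matE mulgK invMg -!(mulgA d^-1%g).
    by rewrite [P (d^-1 * _)%g _]Pl !mulgA.
  by have /lfunP/(_ v) := E; rewrite !comp_lfunE.
- have E : (hcounit DG \o psi_mat P = hcounit DG)%VF.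
    apply: hom_basP => -[g x]; rewrite comp_lfunE dbl_counit_sum.
    under eq_bigr do rewrite psi_matE invg1 mulg1.
    rewrite dbl_counitE -P3 (reindex_inj (mulIg x)).
    by apply: eq_bigr => y _; rewrite mulgK.
  by have /lfunP/(_ v) := E; rewrite comp_lfunE.
- have E : (psi_mat P \o hanti DG = hanti DG \o psi_mat P)%VF.
    apply: hom_basP => -[g x]; apply/ffunP => -[c d]; rewrite !comp_lfunE.
    rewrite dbl_anti_coord [hanti DG _]dbl_antiE !psi_matE.
    have PVV u w : P u^-1%g w^-1%g = P u w by rewrite PV invgK.
    have E1 : (x^-1 * g^-1 * x * c^-1)^-1%g = (c * g ^ x)%g.
      by rewrite conjgE !invMg !invgK.
    have E2 : (d * x^-1^-1)^-1%g = (x^-1 * d^-1)%g by rewrite invgK invMg.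
    rewrite -PVV E1 E2 conjVg invgK [RHS]Pr.
    (* Off the center both sides vanish; on it [d] and [x^-1] differ by a central factor and
       conjugate alike. *)
    have [tZ|tZ] := boolP ((x^-1 * d^-1)%g \in 'Z([set: gT])); last first.
      have P0 u : P u (x^-1 * d^-1)%g = 0.
        by apply/eqP/negPn/negP => /PZ; rewrite (negPf tZ) andbF.
      by rewrite !P0.
    have -> : (c ^ d = c ^ x^-1)%g.
      by rewrite -[d in LHS](mulgK x) conjg_centralM // -groupV invMg.
    by rewrite -[RHS](PJ _ _ x) conjMg conjgKV Pl.
  by have /lfunP/(_ v) := E; rewrite !comp_lfunE.
Qed.

End HopfMatrices.

(** * Nondegenerate pairings on abelian groups *)

Section Pairing.
Variable k : closedFieldType.
Hypothesis char0 : [pchar k]%R =i pred0.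
Local Open Scope ring_scope.

Lemma natr_neq0 n : (0 < n)%N -> n%:R != 0 :> k.
Proof. by rewrite ((pcharf0P k).1 char0) -lt0n. Qed.

(** [X^n - 1] splits, and is separable because [n] is invertible; its [n] distinct roots include a
    primitive one. *)
Lemma prim_root_exists n : (0 < n)%N -> exists z : k, n.-primitive_root z.
Proof.
move=> n_gt0; have [r Dr] := closed_field_poly_normal ('X^n - 1 : {poly k}).
rewrite lead_coefDl ?size_polyXn ?size_polyN ?size_poly1 // lead_coefXn in Dr.
rewrite scale1r in Dr.
have sz_r : (n <= size r)%N.
  by rewrite -ltnS -(size_prod_XsubC _ id) -Dr size_XnsubC.
have rn1 : all n.-unity_root r.
  by apply/allP => z; rewrite -root_prod_XsubC -Dr.
have [|z _ pz] := hasP (has_prim_root n_gt0 rn1 _ sz_r); last by exists z.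
by rewrite -separable_prod_XsubC -Dr separable_Xn_sub_1 ?natr_neq0.
Qed.

(** Multiplicativity in the second variable follows from symmetry; the last clause is
    nondegeneracy. *)
Definition sym_pairing (gT : finGroupType) (A : {set gT}) (b : gT -> gT -> k) :=
  [/\ {in A, forall x, b 1%g x = 1},
      {in A & A & A, forall x y z, b (x * y)%g z = b x z * b y z},
      {in A &, forall x y, b x y = b y x}
    & {in A, forall x, {in A, forall y, b x y = 1} -> x = 1%g}].

(** The pairing is [(g ^+ i, g ^+ j) |-> w ^+ (i * j)] for [w] a primitive root of order [#[g]]. *)
Lemma cycle_pairing (gT : finGroupType) (g : gT) :
  exists b, sym_pairing <[g]> b.
Proof.
have [w pw] := prim_root_exists (order_gt0 g).
(* A discrete logarithm, with default 0 off [<[g]>]. *)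
pose log x :=
  if [pick i : 'I_#[g] | x == (g ^+ i)%g] is Some i then i : nat else 0%N.
have logK x : x \in <[g]> -> (g ^+ log x)%g = x.
  rewrite /log => /cyclePmin[i ilt ->]; case: pickP => [j /eqP //|].
  by move=> /(_ (Ordinal ilt)); rewrite eqxx.
have wE i j m : (g ^+ i = g ^+ j)%g -> w ^+ (i * m)%N = w ^+ (j * m)%N.
  move=> /eqP; rewrite eq_expg_mod_order => ij; apply/eqP.
  rewrite (eq_prim_root_expr pw) -modnMml; move/eqP: ij => ->.
  by rewrite modnMml.
exists (fun x y => w ^+ (log x * log y)%N); split.
- move=> x _; rewrite (wE _ 0%N) ?mul0n //.
  by rewrite logK ?group1.
- move=> x y z xg yg zg; rewrite -exprD -mulnDl; apply: wE.
  by rewrite expgD !logK ?groupM.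
- by move=> x y _ _; rewrite mulnC.
(* Pairing with the generator gives [w ^+ log x = 1], so [#[g]] divides [log x]. *)
move=> x xg /(_ g (cycle_id g)); rewrite mulnC (wE _ 1%N) ?logK ?cycle_id //.
move/eqP; rewrite mul1n -(prim_order_dvd pw) => /dvdnP[m Dm].
by rewrite -(logK x xg) Dm mulnC expgM expg_order expg1n.
Qed.

(** Multiply the pairings of the components; testing against [K] and [H] separately gives
    nondegeneracy. *)
Lemma dprod_pairing (gT : finGroupType) (K H G : {group gT}) bK bH :
  K \x H = G -> sym_pairing K bK -> sym_pairing H bH ->
  exists b, sym_pairing G b.
Proof.
move=> /dprodP[_ KHG cKH tiKH] [K1 KM KS KN] [H1 HM HS HN].
pose p x : gT := divgr K H x; pose q x : gT := remgr K H x.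
have pK x : x \in G -> p x \in K by rewrite -KHG; exact: mem_divgr.
have qH x : x \in G -> q x \in H by rewrite -KHG; exact: mem_remgr.
have pqE x : x = (p x * q x)%g := divgr_eq K H x.
have pE x y : x \in K -> y \in H -> p (x * y)%g = x by exact: divgrMid.
have qE x y : x \in K -> y \in H -> q (x * y)%g = y by exact: remgrMid.
clearbody p q.
have mE x y : x \in G -> y \in G -> (x * y = (p x * p y) * (q x * q y))%g.
  move=> xG yG; have cqp : commute (q x) (p y).
    exact: (centsP cKH) (qH x xG) _ (pK y yG).
  by rewrite {1}(pqE x) {1}(pqE y) -!mulgA; congr (_ * _)%g; rewrite !mulgA cqp.
have pM x y : x \in G -> y \in G -> p (x * y)%g = (p x * p y)%g.
  by move=> xG yG; rewrite mE // pE ?groupM ?pK ?qH.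
have qM x y : x \in G -> y \in G -> q (x * y)%g = (q x * q y)%g.
  by move=> xG yG; rewrite mE // qE ?groupM ?pK ?qH.
have KG x : x \in K -> x \in G by apply/subsetP; rewrite -KHG mulG_subl.
have HG x : x \in H -> x \in G by apply/subsetP; rewrite -KHG mulG_subr.
have p1 : p 1%g = 1%g by rewrite -[1%g in LHS]mulg1 pE.
have q1 : q 1%g = 1%g by rewrite -[1%g in LHS]mulg1 qE.
exists (fun x y => bK (p x) (p y) * bH (q x) (q y)); split.
- by move=> x xG; rewrite p1 q1 K1 ?H1 ?mulr1 ?pK ?qH.
- move=> x y z xG yG zG; rewrite pM // qM // KM ?HM ?pK ?qH //.
  by rewrite mulrACA.
- by move=> x y xG yG; rewrite KS ?pK // HS ?qH.
move=> x xG bx1; have px1 : p x = 1%g.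
  apply: KN => [|y yK]; first exact: pK.
  have := bx1 y (KG y yK); rewrite -(mulg1 y) pE ?group1 // qE ?group1 //.
  by rewrite HS ?group1 ?qH // H1 ?qH // mulr1 mulg1.
have qx1 : q x = 1%g.
  apply: HN => [|y yH]; first exact: qH.
  have := bx1 y (HG y yH); rewrite -(mul1g y) pE ?group1 // qE ?group1 //.
  by rewrite KS ?group1 ?pK // K1 ?pK // mul1r mul1g.
by rewrite (pqE x) px1 qx1 mulg1.
Qed.

Lemma abelian_pairing (gT : finGroupType) (G : {group gT}) :
  abelian G -> exists b, sym_pairing G b.
Proof.
move=> /abelian_structure[s + _]; elim: s G => [|x s IHs] G.
  rewrite big_nil => <-; have [b Pb] := @cycle_pairing gT 1%g.
  by exists b; rewrite -cycle1.
rewrite big_cons => defG; have [[_ H _ defH] _ _ _] := dprodP defG.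
have [b Pb] := IHs H defH; have [c Pc] := @cycle_pairing gT x.
by rewrite defH in defG; exact: dprod_pairing defG Pc Pb.
Qed.

(** For [x != 1], translating by some [y] with [b x y != 1] multiplies the sum by [b x y], so it
    vanishes. *)
Lemma pairing_sum (gT : finGroupType) (b : gT -> gT -> k) x :
  sym_pairing [set: gT] b -> \sum_y b x y = (x == 1)%g%:R * #|gT|%:R.
Proof.
move=> [b1 bM bS bN]; case: eqP => [->|x1].
  by rewrite (eq_bigr (fun=> 1)) => [|y _]; rewrite ?sumr_const ?mul1r ?b1 ?inE.
have [y xy|bx1] := pickP (fun y => b x y != 1); last first.
  by case: x1; apply: bN => [|y _]; rewrite ?inE //; apply/eqP/negbFE/bx1.
rewrite mul0r; apply/eqP; rewrite -[_ == 0]orFb -(negbTE xy) -subr_eq0 -mulf_eq0.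
rewrite mulrBl mul1r subr_eq0 mulr_sumr [eqbRHS](reindex_inj (mulgI y)) /=.
by apply/eqP/eq_bigr => z _; rewrite ![b x _]bS ?bM ?inE.
Qed.

End Pairing.

(** * Fourier transform on the center *)

Section CentralPairing.
Variables (k : fieldType) (gT : finGroupType).
Local Open Scope ring_scope.
Local Notation Z := 'Z([set: gT])%g.
Local Notation zT := (zgrp gT).
Local Notation n := (#|zT|%:R : k).
Implicit Types (z t : zT) (g h u v w x y a b c d : gT) (e : cend gT).

(* A pairing of the center, extended by zero in its second variable. *)
Record central_pairing (beta : zT -> gT -> k) : Prop := CentralPairing {
  cpair_out : forall z u, u \notin Z -> beta z u = 0;
  cpair1l : forall u, u \in Z -> beta 1%g u = 1;
  cpair1r : forall z, beta z 1%g = 1;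
  cpairMl : forall z t u, beta (z * t)%g u = beta z u * beta t u;
  cpairMr : forall z u g, u \in Z -> beta z (u * g)%g = beta z u * beta z g;
  cpair_suml : forall u, \sum_z beta z u = (u == 1%g)%:R * n;
  cpair_sumr : forall z, \sum_u beta z u = (z == 1%g)%:R * n
}.

Variable beta : zT -> gT -> k.
Hypothesis beta_pairing : central_pairing beta.
Hypothesis n_neq0 : n != 0.

Let b0 := cpair_out beta_pairing.
Let b1l := cpair1l beta_pairing.
Let b1r := cpair1r beta_pairing.
Let bMl := cpairMl beta_pairing.
Let bMr := cpairMr beta_pairing.
Let bsuml := cpair_suml beta_pairing.
Let bsumr := cpair_sumr beta_pairing.

Lemma cpairV z u : beta z^-1%g u = beta z u^-1%g.
Proof.
have [uZ|uZ] := boolP (u \in Z); last by rewrite !b0 ?groupV.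
by rewrite -[LHS]mul1r -(b1r z) -(mulVg u) bMr ?groupV // -mulrA -bMl mulgV b1l ?mulr1.
Qed.

(** Gathers the dependence on [s] into the single character [z * t^-1], ready for orthogonality. *)
Lemma cpair_shift z t s u :
  beta z s * beta t (s^-1 * u)%g = beta (z * t^-1)%g s * beta t u.
Proof.
have [sZ|sZ] := boolP (s \in Z); last by rewrite !(b0 _ sZ) !mul0r.
by rewrite bMr ?groupV // bMl cpairV mulrA.
Qed.

Lemma cpair_sumr_eq z t : \sum_u beta (z * t^-1)%g u = (z == t)%:R * n.
Proof. by rewrite bsumr -eq_mulgV1. Qed.

(** The coefficient of [w] in the group algebra product of the sums of [A z] times [f z] and of
    [A' t] times [f' t]. *)
Lemma sum_conv_delta (T : finType) (f f' : T -> gT) (A A' : T -> k) w :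
  \sum_y (\sum_z (f z == y)%:R * A z) * (\sum_t (f' t == y^-1 * w)%g%:R * A' t)
  = \sum_z \sum_t (f z * f' t == w)%g%:R * (A z * A' t).
Proof.
under eq_bigr do rewrite mulr_suml.
rewrite exchange_big; apply: eq_bigr => z _; rewrite (bigD1 (f z)) //= eqxx mul1r.
rewrite [X in _ + X]big1 => [|y /negPf fy]; last by rewrite eq_sym fy !mul0r.
rewrite addr0 mulr_sumr; apply: eq_bigr => t _.
by rewrite -(inj_eq (mulgI (f z))) mulKVg mulrCA.
Qed.

Lemma sum_delta_val (T : finType) (U : eqType) (t : T) (f : T -> U) (w : U)
    (F : T -> k) :
  \sum_z (f z == w)%:R * ((z == t)%:R * F z) = (f t == w)%:R * F t.
Proof.
rewrite (bigD1 t) //= eqxx mul1r big1 ?addr0 // => z /negPf->.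
by rewrite mul0r mulr0.
Qed.

Lemma zvalM z t : sgval (z * t)%g = (sgval z * sgval t)%g.
Proof. by []. Qed.

Lemma zvalV z : sgval z^-1%g = (sgval z)^-1%g.
Proof. by []. Qed.

(** * Matrices of endomorphisms of the center *)

Lemma cend1 e : e 1%g = 1%g.
Proof. by apply: (mulgI (e 1%g)); rewrite -cendM !mulg1. Qed.

Definition end_sum e u w := \sum_z (sgval (e z) == w)%:R * beta z u.
(** The inverse Fourier transform of [e]: [p(e_u)] is the mean over [z] of [beta z u] times
    [e z]. *)
Definition end_mat e u w := n^-1 * end_sum e u w.

Lemma end_mat_hopf e : hopf_mat (end_mat e).
Proof.
have nE (x y : k) : n^-1 * x * (n^-1 * y) = n^-1 * (n^-1 * (x * y)) by ring.
split=> [g a b|g h w|g|w]; rewrite /end_mat.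
- under eq_bigr do rewrite nE; rewrite -!mulr_sumr [RHS]mulrCA; congr (_ * _).
  apply: (canLR (mulKf n_neq0)).
  under eq_bigr do rewrite mulr_suml.
  rewrite exchange_big !mulr_sumr; apply: eq_bigr => z _.
  under eq_bigr do rewrite mulr_sumr.
  rewrite exchange_big /=.
  (* Orthogonality in [u] leaves only [t = z]. *)
  transitivity (\sum_t (sgval (e t) == b)%:R *
      ((t == z)%:R * ((sgval (e z) == a)%:R * beta z g * n))).
    apply: eq_bigr => t _.
    transitivity ((sgval (e t) == b)%:R * ((sgval (e z) == a)%:R * beta z g)
        * \sum_u beta (t * z^-1)%g u); last by rewrite cpair_sumr_eq; ring.
    rewrite mulr_sumr; apply: eq_bigr => u _.
    rewrite mulrACA [beta z _ * _]mulrC cpair_shift; ring.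
  rewrite (sum_delta_val _ (fun t => sgval (e t))) /=.
  have [<-|ab] := eqVneq a b.
    by case: eqP => _ /=; ring.
  by case: eqP => [->|_]; rewrite ?(eq_sym b) ?(negPf ab) /=; ring.
- under eq_bigr do rewrite nE; rewrite -!mulr_sumr [RHS]mulrCA; congr (_ * _).
  rewrite (sum_conv_delta (fun z => sgval (e z)) (fun z => sgval (e z))).
  apply: (canLR (mulKf n_neq0)).
  rewrite exchange_big.
  transitivity (\sum_t \sum_z (sgval (e z) == w)%:R
      * (beta z g * beta t (g^-1 * h)%g)).
    (* Replacing [z] by [z * t^-1] turns [e z * e t] into [e z]; the sum over [t] then forces
       [g = h]. *)
    apply: eq_bigr => t _; rewrite (reindex_inj (mulIg t^-1%g)).
    by apply: eq_bigr => z _; rewrite cpair_shift -zvalM -cendM mulgKV.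
  rewrite exchange_big !mulr_sumr; apply: eq_bigr => z _.
  rewrite -!mulr_sumr bsuml -eq_mulVg1; ring.
- rewrite -mulr_sumr exchange_big; apply: (canLR (mulKf n_neq0)).
  rewrite mulrC -bsuml; apply: eq_bigr => z _.
  rewrite (bigD1 (sgval (e z))) //= eqxx mul1r big1 ?addr0 // => w.
  by rewrite eq_sym => /negPf->; rewrite mul0r.
- rewrite -mulr_sumr exchange_big; apply: (canLR (mulKf n_neq0)).
  under eq_bigr do rewrite -mulr_sumr bsumr.
  by rewrite (sum_delta_val _ (fun t => sgval (e t))) cend1 eq_sym mulrC.
Qed.

Lemma end_mat_central e : central_mat (end_mat e).
Proof.
move=> u w; apply: contraR; rewrite negb_and => uw.
rewrite /end_mat [X in _ * X]big1 ?mulr0 // => z _.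
case/orP: uw => [uZ|]; first by rewrite b0 ?mulr0.
by case: eqP => [<-|]; rewrite ?mul0r // subgP.
Qed.

Lemma end_matV e u w : end_mat e u^-1%g w = end_mat e u w^-1%g.
Proof.
congr (_ * _); rewrite [LHS](reindex_inj (@invg_inj zT)) /=.
apply: eq_bigr => z _; rewrite cpairV invgK.
have -> : e z^-1%g = (e z)^-1%g.
  by apply: (mulgI (e z)); rewrite -cendM !mulgV cend1.
by rewrite -(inj_eq (@invg_inj gT)) zvalV invgK.
Qed.

(** The Fourier transform turns convolution into the pointwise product: the sum over [s] leaves only
    [t = z]. *)
Lemma end_mat_conv e e' u w :
  mat_conv (end_mat e) (end_mat e') u w = end_mat (e * e')%g u w.
Proof.
transitivity (n^-1 * (n^-1 * \sum_s \sum_z \sum_t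
    (sgval (e z) * sgval (e' t) == w)%g%:R * (beta z s * beta t (u * s^-1)%g))).
  rewrite !mulr_sumr; apply: eq_bigr => s _.
  rewrite -(sum_conv_delta (fun z => sgval (e z)) (fun t => sgval (e' t))
    (beta^~ s) (beta^~ (u * s^-1)%g)) !mulr_sumr.
  by apply: eq_bigr => y _; rewrite /end_mat /end_sum; ring.
congr (_ * _); apply: (canLR (mulKf n_neq0)).
rewrite exchange_big mulr_sumr; apply: eq_bigr => z _; rewrite exchange_big /=.
transitivity (\sum_t (sgval (e z) * sgval (e' t) == w)%g%:R *
    ((t == z)%:R * (n * beta t u))); last first.
  rewrite (sum_delta_val _ (fun t => sgval (e z) * sgval (e' t))%g).
  by rewrite !ffunE zvalM; ring.
apply: eq_bigr => t _; rewrite -mulr_sumr; congr (_ * _).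
transitivity (beta t u * \sum_s beta (z * t^-1)%g s); last first.
  by rewrite cpair_sumr_eq eq_sym; ring.
rewrite mulr_sumr; apply: eq_bigr => s _; rewrite [RHS]mulrC -cpair_shift.
have [sZ|sZ] := boolP (s \in Z); last by rewrite !(b0 _ sZ) !mul0r.
by rewrite (@centralM _ s^-1%g) ?groupV.
Qed.

Lemma end_mat1 u w : end_mat 1%g u w = (u == 1%g)%:R * (w == 1%g)%:R.
Proof.
apply: (canLR (mulKf n_neq0)); rewrite mulrA (mulrC n) -bsuml mulr_suml.
by apply: eq_bigr => z _; rewrite ffunE mulrC eq_sym.
Qed.

(** Fourier inversion: it recovers [e] from its matrix. *)
Lemma end_mat_coef e z w :
  \sum_u beta z^-1%g u * end_mat e u w = (sgval (e z) == w)%:R.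
Proof.
transitivity (n^-1 * \sum_t (sgval (e t) == w)%:R * ((t == z)%:R * n)); last first.
  by rewrite (sum_delta_val _ (fun t => sgval (e t))) mulrC mulfK.
under eq_bigr do rewrite /end_mat mulrCA mulr_sumr.
rewrite -mulr_sumr exchange_big; congr (_ * _); apply: eq_bigr => t _.
rewrite -cpair_sumr_eq mulr_sumr; apply: eq_bigr => u _; rewrite bMl; ring.
Qed.

Lemma end_mat_inj e e' : (forall u w, end_mat e u w = end_mat e' u w) -> e = e'.
Proof.
move=> ee'; apply/val_inj/ffunP => z; apply/val_inj/eqP.
have := end_mat_coef e z (sgval (e z)); under eq_bigr do rewrite ee'.
rewrite end_mat_coef eqxx eq_sym; case: eqP => // _ /eqP.
by rewrite eq_sym oner_eq0.
Qed.

(* The Fourier transform of [P] in the first variable sends [z] to a grouplike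
   element of [k Z(G)], that is to an element [ez z] of [Z(G)]. *)
Lemma hopf_mat_end P : hopf_mat P -> central_mat P ->
  exists e, forall u w, P u w = end_mat e u w.
Proof.
move=> [P1 P2 P3 P4] PZ; pose F z w := \sum_u beta z^-1%g u * P u w.
have FF z a b : F z a * F z b = (a == b)%:R * F z a.
  rewrite [LHS]mulrC mulr_suml.
  transitivity (\sum_u \sum_g beta z^-1%g g * (P (u^-1 * g)%g a * P u b)).
    apply: eq_bigr => u _; rewrite [F z a](reindex_inj (mulgI u^-1%g)) mulr_sumr.
    apply: eq_bigr => g _.
    (* Rows off the center vanish; at a central [u] the character [beta z^-1] is multiplicative. *)
    have [->|/PZ/andP[uZ _]] := eqVneq (P u b) 0; first by ring.
    have -> : beta z^-1%g g = beta z^-1%g u * beta z^-1%g (u^-1 * g)%g.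
      by rewrite -bMr // mulKVg.
    ring.
  rewrite exchange_big mulr_sumr; apply: eq_bigr => g _.
  by rewrite -mulr_sumr P1 mulrCA.
have F1 z : \sum_w F z w = 1.
  rewrite exchange_big /=; under eq_bigr do rewrite -mulr_sumr P3.
  rewrite (bigD1 1%g) //= b1r eqxx mulr1 big1 ?addr0 // => u /negPf->.
  by rewrite mulr0.
have exF z : exists w, F z w != 0.
  have [w Fw|F0] := pickP (fun w => F z w != 0); first by exists w.
  have /eqP := F1 z; rewrite big1 => [|w _]; first by rewrite eq_sym oner_eq0.
  exact/eqP/negbFE/F0.
pose ez z := xchoose (exF z).
(* By [FF], distinct coefficients of [F z] annihilate each other and a nonzero one equals 1, so
   [F z] is one group element. *)
have FE z w : F z w = (ez z == w)%:R.
  have F0 : F z (ez z) != 0 := xchooseP (exF z).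
  case: eqP => [<-|/eqP ne]; apply: (mulIf F0).
    by rewrite FF eqxx.
  by rewrite FF eq_sym (negPf ne) !mul0r.
have ezZ z : ez z \in Z.
  apply: contraT => zZ; have /eqP := FE z (ez z); rewrite eqxx /F big1.
    by rewrite eq_sym oner_eq0.
  move=> u _; have [->|/PZ/andP[_]] := eqVneq (P u (ez z)) 0; first exact: mulr0.
  by rewrite (negPf zZ).
have ezM z t : ez (z * t)%g = (ez z * ez t)%g.
  have : F (z * t)%g (ez z * ez t)%g = 1.
    (* Orthogonality of the rows of [P] makes [F (z * t)] the convolution of [F z] and [F t]. *)
    transitivity (\sum_y F z y * F t (y^-1 * (ez z * ez t))%g); last first.
      rewrite (bigD1 (ez z)) //= mulKg !FE !eqxx mulr1 big1 ?addr0 // => y.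
      by rewrite FE eq_sym => /negPf->; rewrite mul0r.
    under [RHS]eq_bigr do rewrite mulr_suml.
    rewrite exchange_big; apply: eq_bigr => u _ /=.
    under [RHS]eq_bigr do rewrite mulr_sumr.
    rewrite exchange_big (bigD1 u) //= [X in _ + X]big1 => [|v vu]; last first.
      under eq_bigr do rewrite mulrACA.
      by rewrite -mulr_sumr P2 eq_sym (negPf vu) mul0r mulr0.
    under eq_bigr do rewrite mulrACA.
    by rewrite -mulr_sumr P2 eqxx addr0 mul1r invMg bMl [beta t^-1%g _ * _]mulrC.
  by rewrite FE; case: eqP => // _ /eqP; rewrite eq_sym oner_eq0.
have em : morphic [set: zT] [ffun z => Subg (ezZ z)].
  by apply/morphicP => z t _ _; apply: val_inj; rewrite !ffunE /= ezM.
exists (CEnd em) => u w; apply/esym/(canLR (mulKf n_neq0)).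
(* Fourier inversion: summing over [z] leaves [v = u]. *)
transitivity (\sum_z F z w * beta z u).
  by apply: eq_bigr => z _; rewrite FE ffunE.
under eq_bigr do rewrite mulr_suml.
rewrite exchange_big (bigD1 u) //= [X in _ + X]big1 => [|v vu].
  rewrite addr0 mulrC; have [->|/PZ/andP[uZ _]] := eqVneq (P u w) 0.
    by rewrite big1 ?mul0r // => z _; rewrite mulr0 mul0r.
  rewrite (eq_bigr (fun=> P u w)) => [|z _]; last first.
    by rewrite mulrAC -bMl mulVg b1l ?mul1r.
  by rewrite sumr_const mulr_natr.
have [->|/PZ/andP[vZ _]] := eqVneq (P v w) 0.
  by apply: big1 => z _; rewrite mulr0 mul0r.
rewrite (eq_bigr (fun z => P v w * beta z (v^-1 * u)%g)) => [|z _].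
  by rewrite -mulr_sumr bsuml -eq_mulVg1 (negPf vu) mul0r mulr0.
rewrite bMr ?groupV // -cpairV; ring.
Qed.

End CentralPairing.

(** * The isomorphism *)

Lemma central_pairing_exists (k : closedFieldType) (gT : finGroupType) :
  [pchar k]%R =i pred0 ->
  exists beta : zgrp gT -> gT -> k, central_pairing beta.
Proof.
move=> char0; have cZ : abelian [set: zgrp gT].
  by apply/centsP => x _ y _; exact: zgrpC.
have [b Pb] := abelian_pairing char0 cZ.
have [b1 bM bS _] := Pb; pose Z := 'Z([set: gT])%G.
have subM u v : u \in Z -> v \in Z ->
    subg Z (u * v) = (subg Z u * subg Z v) :> zgrp gT.
  exact: subgM.
(* The test replaces the default value of [subg Z] off the center by 0. *)
exists (fun z u => if u \in Z then b z (subg Z u) else 0%R); split.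
- by move=> z u /negPf->.
- by move=> u ->; rewrite b1 ?inE.
- by move=> z; rewrite group1 morph1 bS ?inE // b1 ?inE.
- by move=> z t u; case: ifP => _; rewrite ?mulr0 // bM ?inE.
- move=> z u g uZ; rewrite uZ groupMl //; case: ifP => gZ; last by rewrite mulr0.
  by rewrite subM // ![b z _]bS ?inE // bM ?inE.
- move=> u; case uZ: (u \in Z); last first.
    have u1 : (u == 1) = false by apply: contraFF uZ => /eqP->; rewrite group1.
    by rewrite big1 // u1 mul0r.
  under eq_bigr do rewrite bS ?inE //.
  rewrite (pairing_sum _ Pb); congr ((nat_of_bool _)%:R * _)%R.
  by rewrite -(inj_eq val_inj) [val _](subgK _ uZ).
- move=> z; rewrite (@sum_image _ _ _ (@sgval gT Z) (subg Z)).
  + under eq_bigr do rewrite subgP sgvalK.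
    exact: pairing_sum Pb.
  + exact: sgvalK.
  by move=> u; case: ifP => // uZ; rewrite [sgval _]subgK // eqxx.
Qed.

Section LambdaEnd.
Variables (k : fieldType) (gT : finGroupType) (beta : zgrp gT -> gT -> k).
Hypothesis beta_pairing : central_pairing beta.
Hypothesis card_neq0 : (#|zgrp gT|%:R != 0 :> k)%R.
Local Notation DG := (drinfeld_double k gT).

Let psi (e : cend gT) := psi_mat (end_mat beta e).

Let psiM e e' : (psi e \o psi e')%VF = psi (e * e').
Proof.
rewrite /psi psi_mat_comp; congr psi_mat; apply/funext => u; apply/funext => w.
exact: end_mat_conv.
Qed.

Let psi1 : psi 1 = \1%VF.
Proof. by apply: psi_mat_id => u w; exact: end_mat1. Qed.

Fact psi_end_aut e : is_hopf_aut DG (psi e).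
Proof.
split.
  apply: psi_mat_hopf_mor; first exact: end_mat_hopf.
    exact: end_mat_central.
  exact: end_matV.
by exists (psi e^-1) => v; rewrite -comp_lfunE psiM ?mulVg ?mulgV psi1 id_lfunE.
Qed.

Definition end_aut e : hopf_aut DG := HopfAut (asboolT (psi_end_aut e)).

Fact end_autM : {morph end_aut : e e' / e * e'}.
Proof. by move=> e e'; apply: val_inj; rewrite /= -psiM. Qed.
HB.instance Definition _ := isMultiplicative.Build _ _ end_aut end_autM.

Lemma end_aut_inj : injective end_aut.
Proof.
move=> e e' /(congr1 val) /= ee'.
apply: (end_mat_inj beta_pairing card_neq0) => u w.
(* The coefficient of [psi e (e_u # 1)] at [e_1 # w] is the matrix entry at [u], [w]. *)
have := psi_matE (end_mat beta e) u 1 1 w; rewrite -/(psi e) ee' psi_matE.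
by rewrite invg1 !mulg1.
Qed.

(** An [f] in [Lambda] is by type an automorphism, so its matrix is a class function, hence central,
    hence comes from an endomorphism. *)
Lemma Lambda_end_aut f : f \in Lambda k gT <-> exists e, f = end_aut e.
Proof.
split=> [/asboolP[p [pm /has_psi_formP fE]]|[e ->]].
  have Pm := hopf_mor_mat pm; have [fm _] := hopf_autP f.
  rewrite fE in fm; have [Pu Pw] := psi_mat_class Pm fm.
  have PZ := class_central_mat Pm Pu Pw.
  have [e Pe] := hopf_mat_end beta_pairing card_neq0 Pm PZ.
  exists e; apply: val_inj; rewrite [LHS]fE /=; congr psi_mat.
  by apply/funext => u; apply/funext => w; exact: Pe.
apply/asboolP; exists (mat_hom (end_mat beta e)); split.
  by apply: mat_hopf_mor; [exact: end_mat_hopf | exact: end_matV].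
apply/has_psi_formP; congr psi_mat; apply/funext => u; apply/funext => w.
by rewrite mat_homE.
Qed.

End LambdaEnd.

Theorem proposition4p2 (k : closedFieldType) (char0 : [pchar k]%R =i pred0)
    (gT : finGroupType) :
  [/\ group_closed (Lambda k gT),
      {in Lambda k gT &, forall f g, f * g = g * f}
    & exists phi : {multiplicative cend gT -> hopf_aut (drinfeld_double k gT)},
        injective phi /\ (forall f, f \in Lambda k gT <-> exists e, f = phi e)].
Proof.
have [beta Pb] := central_pairing_exists gT char0.
have card_neq0 : (#|zgrp gT|%:R != 0 :> k)%R.
  by apply: natr_neq0 => //; rewrite -cardsT cardG_gt0.
pose phi : {multiplicative cend gT -> hopf_aut (drinfeld_double k gT)} :=
  end_aut Pb card_neq0.
have LP f : f \in Lambda k gT <-> exists e, f = phi e by exact: Lambda_end_aut.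
(* The morphism structure of [phi] records products; unit and inverses follow by cancellation. *)
have phi1 : phi 1 = 1 by apply: (mulgI (phi 1)); rewrite -gmulfM !mulg1.
have phiV e : phi e^-1 = (phi e)^-1.
  by apply: (mulgI (phi e)); rewrite -gmulfM !mulgV phi1.
split.
- split=> [|f g /LP[e ->] /LP[e' ->]]; apply/LP; first by exists 1; rewrite phi1.
  by exists (e * e'^-1); rewrite gmulfM phiV.
- move=> f g /LP[e ->] /LP[e' ->]; rewrite -!gmulfM; congr (phi _).
  by apply/val_inj/ffunP => z; rewrite !ffunE zgrpC.
by exists phi; split=> //; exact: end_aut_inj.
Qed.
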